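(* Given $F : X \to \sum_{A : \mathcal{U}} \mathrm{isAmazinglyCov}(A)$, the type family $F_0 = \pi_1 \circ F : X \to \mathcal{U}$ is covariant.
   Context: Setting: triangulated type theory: univalent homotopy type theory with modalities $\mathsf{p}\dashv\mathsf{a}$ where $\mathsf{p}$ internalizes $\mathbb{I}\to-$ (context extension by $i:\mathbb{I}$) and $\mathsf{a}$ is its amazing right adjoint, and a directed interval $\mathbb{I}$ (an h-set bounded distributive lattice with $0\ne1$). A family $A : X \to \mathcal{U}$ is covariant if for every $x : \mathbb{I}\to X$ and $a_0 : A(x\,0)$, the type $\sum_{a_1 : A(x\,1)} (a_0 \to_x a_1)$ of dependent arrows is contractible. A type $A$ is amazingly covariant, $\mathrm{isAmazinglyCov}(A) = \langle\mathsf{a}\mid \mathrm{isCov}(\lambda i.\,A^\eta\cdot i)\rangle$, meaning $A$ is covariant over the entire ambient context. *)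

(* Defs.v *)
(* A deep embedding of multimodal type theory with one mode, modalities freely
   generated by an adjunction p -| a, univalent universes and a directed
   interval I such that locking by p is context extension by I.

   The calculus is presented with explicit substitutions.  A de Bruijn variable
   is [var] under iterated weakenings.  Judgements concern raw expressions;
   "A is a type in context G" means that A is a term of some universe. *)
From Stdlib Require Import List.
Import ListNotations.

Inductive gen : Type := gp | ga.

(* [n ++ m] is the composite of n after m, so that locking a context by [n ++ m]
   locks it by n first and then by m. *)
Definition modality : Type := list gen.

(* Closed primitive constants; [Extra k] are those added by a signature. *)
Inductive const (K : Type) : Type :=
| Empty | Absurd (n : nat) | Univalence (n : nat)
| Int | I0 | I1 | Meet | Join
| IntSet | I0neI1
| MeetC | MeetA | MeetJoin | Meet1
| JoinC | JoinA | JoinMeet | Join0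
| MeetDistr
| Extra (k : K).

Inductive tm (K : Type) : Type :=
| var (m : modality)
| sb (t : tm K) (s : su K)
| cst (c : const K)
| U (n : nat)
| Pi (m : modality) (A B : tm K)
| lam (m : modality) (t : tm K)
| tapp (m : modality) (t u : tm K)
| Sig (A B : tm K)
| tpair (t u : tm K)
| pr1 (t : tm K)
| pr2 (t : tm K)
| Id (A t u : tm K)
| trefl (t : tm K)
| J (C d e : tm K)
| Mod (m : modality) (A : tm K)
| mkmod (m : modality) (t : tm K)
| letmod (n m : modality) (C t u : tm K)
with su (K : Type) : Type :=
| sid
| scomp (s r : su K)
| sbang
| wk
| sext (m : modality) (s : su K) (t : tm K)
| slock (g : gen) (s : su K)
(* The 2-cells eta : 1 => a o p and eps : p o a => 1 act contravariantly on
   locks: [seta : G.{a}.{p} -> G] and [seps : G -> G.{p}.{a}]. *)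
| seta
| seps
(* [sp2I : G.{p} -> G.I] and its inverse [sI2p]. *)
| sp2I
| sI2p.

Inductive ctx (K : Type) : Type :=
| cemp
| cext (G : ctx K) (m : modality) (A : tm K)
| clock (G : ctx K) (g : gen).

Arguments Empty {K}. Arguments Absurd {K} n. Arguments Univalence {K} n.
Arguments Int {K}. Arguments I0 {K}. Arguments I1 {K}.
Arguments Meet {K}. Arguments Join {K}.
Arguments IntSet {K}. Arguments I0neI1 {K}.
Arguments MeetC {K}. Arguments MeetA {K}. Arguments MeetJoin {K}.
Arguments Meet1 {K}. Arguments JoinC {K}. Arguments JoinA {K}.
Arguments JoinMeet {K}. Arguments Join0 {K}. Arguments MeetDistr {K}.
Arguments Extra {K} k.
Arguments var {K} m. Arguments sb {K} t s. Arguments cst {K} c.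
Arguments U {K} n. Arguments Pi {K} m A B. Arguments lam {K} m t.
Arguments tapp {K} m t u. Arguments Sig {K} A B. Arguments tpair {K} t u.
Arguments pr1 {K} t. Arguments pr2 {K} t. Arguments Id {K} A t u.
Arguments trefl {K} t. Arguments J {K} C d e. Arguments Mod {K} m A.
Arguments mkmod {K} m t. Arguments letmod {K} n m C t u.
Arguments sid {K}. Arguments scomp {K} s r. Arguments sbang {K}.
Arguments wk {K}. Arguments sext {K} m s t. Arguments slock {K} g s.
Arguments seta {K}. Arguments seps {K}.
Arguments sp2I {K}. Arguments sI2p {K}.
Arguments cemp {K}. Arguments cext {K} G m A. Arguments clock {K} G g.

Fixpoint clocks {K : Type} (G : ctx K) (m : modality) : ctx K :=
  match m with
  | [] => G
  | g :: m' => clocks (clock G g) m'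
  end.

Fixpoint slocks {K : Type} (s : su K) (m : modality) : su K :=
  match m with
  | [] => s
  | g :: m' => slocks (slock g s) m'
  end.

(* For s : D -> G, [lift m s : D.(m | A[s.{m}]) -> G.(m | A)]. *)
Definition lift {K : Type} (m : modality) (s : su K) : su K :=
  sext m (scomp s wk) (var m).

Definition inst {K : Type} (m : modality) (t : tm K) : su K := sext m sid t.

Definition up {K : Type} (t : tm K) : tm K := sb t wk.

Fixpoint v {K : Type} (n : nat) : tm K :=
  match n with
  | O => var []
  | S n' => up (v n')
  end.

Definition PiI {K : Type} (B : tm K) : tm K := Pi [] (cst Int) B.
Definition ap {K : Type} (t u : tm K) : tm K := tapp [] t u.
Definition arr {K : Type} (A B : tm K) : tm K := Pi [] A (up B).
Definition times {K : Type} (A B : tm K) : tm K := Sig A (up B).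
Definition i0 {K : Type} : tm K := cst I0.
Definition i1 {K : Type} : tm K := cst I1.
Definition meet {K : Type} (t u : tm K) : tm K := ap (ap (cst Meet) t) u.
Definition join {K : Type} (t u : tm K) : tm K := ap (ap (cst Join) t) u.
Definition eqI {K : Type} (t u : tm K) : tm K := Id (cst Int) t u.

Definition isContr {K : Type} (A : tm K) : tm K :=
  Sig A (Pi [] (up A) (Id (up (up A)) (v 1) (v 0))).

Definition isSet {K : Type} (A : tm K) : tm K :=
  Pi [] A (Pi [] (up A)
    (let E := Id (up (up A)) (v 1) (v 0) in
     Pi [] E (Pi [] (up E) (Id (up (up E)) (v 1) (v 0))))).

Definition hasLinv {K : Type} (A B f : tm K) : tm K :=
  Sig (arr B A)
    (Pi [] (up A) (Id (up (up A)) (ap (v 1) (ap (up (up f)) (v 0))) (v 0))).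

Definition hasRinv {K : Type} (A B f : tm K) : tm K :=
  Sig (arr B A)
    (Pi [] (up B) (Id (up (up B)) (ap (up (up f)) (ap (v 1) (v 0))) (v 0))).

Definition isEquiv {K : Type} (A B f : tm K) : tm K :=
  times (hasLinv A B f) (hasRinv A B f).

Definition Equiv {K : Type} (A B : tm K) : tm K :=
  Sig (arr A B) (isEquiv (up A) (up B) (v 0)).

Definition idEquiv {K : Type} : tm K :=
  let idf := lam [] (v 0) in
  let inv := tpair idf (lam [] (trefl (v 0))) in
  tpair idf (tpair inv inv).

(* The canonical map from [Id (U n) A B] to [Equiv A B], by path induction. *)
Definition idToEquiv {K : Type} (A : tm K) : tm K :=
  lam [] (J (Equiv (up (up (up A))) (v 1)) idEquiv (v 0)).

Definition darr {K : Type} (A x a0 a1 : tm K) : tm K :=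
  Sig (PiI (ap (up A) (ap (up x) (v 0))))
    (times (Id (ap (up A) (ap (up x) i0)) (ap (v 0) i0) (up a0))
          (Id (ap (up A) (ap (up x) i1)) (ap (v 0) i1) (up a1))).

(* A is a term of type X -> U, not a type in the extended context. *)
Definition isCov {K : Type} (X A : tm K) : tm K :=
  Pi [] (arr (cst Int) X)
    (Pi [] (ap (up A) (ap (v 0) i0))
      (isContr
        (Sig (ap (up (up A)) (ap (v 1) i1))
          (darr (up (up (up A))) (v 2) (v 1) (v 0))))).

(* For A : U in G, [sb A seta] lives in G.{a}.{p}, and substituting along
   [sI2p : G.{a}.I -> G.{a}.{p}] instantiates the lock p at the last variable. *)
Definition isAmazinglyCov {K : Type} (A : tm K) : tm K :=
  Mod [ga] (isCov (cst Int) (lam [] (sb (sb A seta) sI2p))).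

(* Closed constants and closed judgmental equations on top of the core theory
   (inductive types, higher inductive types, further axioms); [sg_eq t u A]
   postulates t = u : A. *)
Record signature : Type := Signature {
  sg_const : Type;
  sg_type : sg_const -> tm sg_const;
  sg_eq : tm sg_const -> tm sg_const -> tm sg_const -> Prop
}.

Definition Ctx (S : signature) : Type := ctx (sg_const S).
Definition Tm (S : signature) : Type := tm (sg_const S).
Definition Su (S : signature) : Type := su (sg_const S).

Definition const_type (S : signature) (c : const (sg_const S)) : Tm S :=
  match c with
  | Empty => U 0
  | Absurd n => Pi [] (U n) (arr (cst Empty) (v 0))
  | Univalence n =>
      Pi [] (U n) (Pi [] (U n)
        (isEquiv (Id (U n) (v 1) (v 0)) (Equiv (v 1) (v 0)) (idToEquiv (v 1))))
  | Int => U 0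
  | I0 => cst Int
  | I1 => cst Int
  | Meet => arr (cst Int) (arr (cst Int) (cst Int))
  | Join => arr (cst Int) (arr (cst Int) (cst Int))
  | IntSet => isSet (cst Int)
  | I0neI1 => arr (eqI i0 i1) (cst Empty)
  | MeetC => PiI (PiI (eqI (meet (v 1) (v 0)) (meet (v 0) (v 1))))
  | MeetA => PiI (PiI (PiI
      (eqI (meet (v 2) (meet (v 1) (v 0))) (meet (meet (v 2) (v 1)) (v 0)))))
  | MeetJoin => PiI (PiI (eqI (meet (v 1) (join (v 1) (v 0))) (v 1)))
  | Meet1 => PiI (eqI (meet (v 0) i1) (v 0))
  | JoinC => PiI (PiI (eqI (join (v 1) (v 0)) (join (v 0) (v 1))))
  | JoinA => PiI (PiI (PiI
      (eqI (join (v 2) (join (v 1) (v 0))) (join (join (v 2) (v 1)) (v 0)))))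
  | JoinMeet => PiI (PiI (eqI (join (v 1) (meet (v 1) (v 0))) (v 1)))
  | Join0 => PiI (eqI (join (v 0) i0) (v 0))
  | MeetDistr => PiI (PiI (PiI
      (eqI (meet (v 2) (join (v 1) (v 0)))
           (join (meet (v 2) (v 1)) (meet (v 2) (v 0))))))
  | Extra k => sg_type S k
  end.

Inductive ctx_ok (S : signature) : Ctx S -> Prop :=
| ok_emp : ctx_ok S cemp
| ok_ext G m A i :
    ctx_ok S G -> has_type S (clocks G m) A (U i) -> ctx_ok S (cext G m A)
| ok_lock G g : ctx_ok S G -> ctx_ok S (clock G g)

with ctx_eq (S : signature) : Ctx S -> Ctx S -> Prop :=
| ceq_refl G : ctx_ok S G -> ctx_eq S G G
| ceq_sym G D : ctx_eq S G D -> ctx_eq S D G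
| ceq_trans G D E : ctx_eq S G D -> ctx_eq S D E -> ctx_eq S G E
| ceq_ext G D m A B i :
    ctx_eq S G D -> tm_eq S (clocks G m) A B (U i) ->
    ctx_eq S (cext G m A) (cext D m B)
| ceq_lock G D g : ctx_eq S G D -> ctx_eq S (clock G g) (clock D g)

with has_type (S : signature) : Ctx S -> Tm S -> Tm S -> Prop :=
| ty_conv G t A B i :
    has_type S G t A -> tm_eq S G A B (U i) -> has_type S G t B
| ty_ctx G D t A : ctx_eq S G D -> has_type S G t A -> has_type S D t A
| ty_var G m A :
    ctx_ok S (cext G m A) ->
    has_type S (clocks (cext G m A) m) (var m) (sb A (slocks wk m))
| ty_sb G D s t A :
    sub S G s D -> has_type S D t A -> has_type S G (sb t s) (sb A s)
| ty_cst G c i :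
    ctx_ok S G -> has_type S cemp (const_type S c) (U i) ->
    has_type S G (cst c) (sb (const_type S c) sbang)
| ty_U G i : ctx_ok S G -> has_type S G (U i) (U (Datatypes.S i))
| ty_cumul G A i : has_type S G A (U i) -> has_type S G A (U (Datatypes.S i))
| ty_Pi G m A B i :
    has_type S (clocks G m) A (U i) -> has_type S (cext G m A) B (U i) ->
    has_type S G (Pi m A B) (U i)
| ty_lam G m A B t i :
    has_type S (clocks G m) A (U i) -> has_type S (cext G m A) B (U i) ->
    has_type S (cext G m A) t B ->
    has_type S G (lam m t) (Pi m A B)
| ty_app G m A B t u i :
    has_type S (clocks G m) A (U i) -> has_type S (cext G m A) B (U i) ->
    has_type S G t (Pi m A B) -> has_type S (clocks G m) u A ->
    has_type S G (tapp m t u) (sb B (inst m u))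
| ty_Sig G A B i :
    has_type S G A (U i) -> has_type S (cext G [] A) B (U i) ->
    has_type S G (Sig A B) (U i)
| ty_pair G A B t u i :
    has_type S G A (U i) -> has_type S (cext G [] A) B (U i) ->
    has_type S G t A -> has_type S G u (sb B (inst [] t)) ->
    has_type S G (tpair t u) (Sig A B)
| ty_pr1 G A B t i :
    has_type S G A (U i) -> has_type S (cext G [] A) B (U i) ->
    has_type S G t (Sig A B) -> has_type S G (pr1 t) A
| ty_pr2 G A B t i :
    has_type S G A (U i) -> has_type S (cext G [] A) B (U i) ->
    has_type S G t (Sig A B) -> has_type S G (pr2 t) (sb B (inst [] (pr1 t)))
| ty_Id G A t u i :
    has_type S G A (U i) -> has_type S G t A -> has_type S G u A ->
    has_type S G (Id A t u) (U i)
| ty_refl G A t i :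
    has_type S G A (U i) -> has_type S G t A ->
    has_type S G (trefl t) (Id A t t)
| ty_J G A t u C d e i j :
    has_type S G A (U i) -> has_type S G t A -> has_type S G u A ->
    has_type S (cext (cext G [] A) [] (Id (up A) (up t) (v 0))) C (U j) ->
    has_type S G d (sb C (sext [] (inst [] t) (trefl t))) ->
    has_type S G e (Id A t u) ->
    has_type S G (J C d e) (sb C (sext [] (inst [] u) e))
| ty_Mod G m A i :
    ctx_ok S G -> has_type S (clocks G m) A (U i) ->
    has_type S G (Mod m A) (U i)
| ty_mod G m A t i :
    ctx_ok S G -> has_type S (clocks G m) A (U i) ->
    has_type S (clocks G m) t A ->
    has_type S G (mkmod m t) (Mod m A)
| ty_letmod G n m A C t u i j :
    has_type S (clocks G (n ++ m)) A (U i) ->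
    has_type S (cext G n (Mod m A)) C (U j) ->
    has_type S (clocks G n) t (Mod m A) ->
    has_type S (cext G (n ++ m) A) u
      (sb C (sext n wk (mkmod m (var (n ++ m))))) ->
    has_type S G (letmod n m C t u) (sb C (inst n t))

with tm_eq (S : signature) : Ctx S -> Tm S -> Tm S -> Tm S -> Prop :=
| teq_refl G t A : has_type S G t A -> tm_eq S G t t A
| teq_sym G t u A : tm_eq S G t u A -> tm_eq S G u t A
| teq_trans G t u w A : tm_eq S G t u A -> tm_eq S G u w A -> tm_eq S G t w A
| teq_conv G t u A B i :
    tm_eq S G t u A -> tm_eq S G A B (U i) -> tm_eq S G t u B
| teq_ctx G D t u A : ctx_eq S G D -> tm_eq S G t u A -> tm_eq S D t u A
| teq_cumul G A B i : tm_eq S G A B (U i) -> tm_eq S G A B (U (Datatypes.S i))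
| teq_sig t u A :
    sg_eq S t u A -> has_type S cemp t A -> has_type S cemp u A ->
    tm_eq S cemp t u A

| teq_Pi_beta G m A B t u i :
    has_type S (clocks G m) A (U i) -> has_type S (cext G m A) B (U i) ->
    has_type S (cext G m A) t B -> has_type S (clocks G m) u A ->
    tm_eq S G (tapp m (lam m t) u) (sb t (inst m u)) (sb B (inst m u))
| teq_Pi_eta G m A B t i :
    has_type S (clocks G m) A (U i) -> has_type S (cext G m A) B (U i) ->
    has_type S G t (Pi m A B) ->
    tm_eq S G t (lam m (tapp m (up t) (var m))) (Pi m A B)
| teq_pr1_beta G A B t u i :
    has_type S G A (U i) -> has_type S (cext G [] A) B (U i) ->
    has_type S G t A -> has_type S G u (sb B (inst [] t)) ->
    tm_eq S G (pr1 (tpair t u)) t A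
| teq_pr2_beta G A B t u i :
    has_type S G A (U i) -> has_type S (cext G [] A) B (U i) ->
    has_type S G t A -> has_type S G u (sb B (inst [] t)) ->
    tm_eq S G (pr2 (tpair t u)) u (sb B (inst [] t))
| teq_Sig_eta G A B t i :
    has_type S G A (U i) -> has_type S (cext G [] A) B (U i) ->
    has_type S G t (Sig A B) ->
    tm_eq S G t (tpair (pr1 t) (pr2 t)) (Sig A B)
| teq_J_beta G A t C d i j :
    has_type S G A (U i) -> has_type S G t A ->
    has_type S (cext (cext G [] A) [] (Id (up A) (up t) (v 0))) C (U j) ->
    has_type S G d (sb C (sext [] (inst [] t) (trefl t))) ->
    tm_eq S G (J C d (trefl t)) d (sb C (sext [] (inst [] t) (trefl t)))
| teq_Mod_beta G n m A C t u i j :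
    has_type S (clocks G (n ++ m)) A (U i) ->
    has_type S (cext G n (Mod m A)) C (U j) ->
    has_type S (clocks G (n ++ m)) t A ->
    has_type S (cext G (n ++ m) A) u
      (sb C (sext n wk (mkmod m (var (n ++ m))))) ->
    tm_eq S G (letmod n m C (mkmod m t) u) (sb u (inst (n ++ m) t))
      (sb C (inst n (mkmod m t)))

| teq_sb_id G t A : has_type S G t A -> tm_eq S G (sb t sid) t A
| teq_sb_comp G D E s r t A :
    sub S G r D -> sub S D s E -> has_type S E t A ->
    tm_eq S G (sb (sb t s) r) (sb t (scomp s r)) (sb A (scomp s r))
| teq_var_sb G D m s A t i :
    sub S G s D -> has_type S (clocks D m) A (U i) ->
    has_type S (clocks G m) t (sb A (slocks s m)) ->
    tm_eq S (clocks G m) (sb (var m) (slocks (sext m s t) m)) t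
      (sb A (slocks s m))
| teq_cst_sb G D s c i :
    sub S G s D -> has_type S cemp (const_type S c) (U i) ->
    tm_eq S G (sb (cst c) s) (cst c) (sb (const_type S c) sbang)
| teq_U_sb G D s i :
    sub S G s D -> tm_eq S G (sb (U i) s) (U i) (U (Datatypes.S i))
| teq_Pi_sb G D s m A B i :
    sub S G s D ->
    has_type S (clocks D m) A (U i) -> has_type S (cext D m A) B (U i) ->
    tm_eq S G (sb (Pi m A B) s)
      (Pi m (sb A (slocks s m)) (sb B (lift m s))) (U i)
| teq_lam_sb G D s m A B t i :
    sub S G s D ->
    has_type S (clocks D m) A (U i) -> has_type S (cext D m A) B (U i) ->
    has_type S (cext D m A) t B ->
    tm_eq S G (sb (lam m t) s) (lam m (sb t (lift m s))) (sb (Pi m A B) s)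
| teq_app_sb G D s m A B t u i :
    sub S G s D ->
    has_type S (clocks D m) A (U i) -> has_type S (cext D m A) B (U i) ->
    has_type S D t (Pi m A B) -> has_type S (clocks D m) u A ->
    tm_eq S G (sb (tapp m t u) s) (tapp m (sb t s) (sb u (slocks s m)))
      (sb (sb B (inst m u)) s)
| teq_Sig_sb G D s A B i :
    sub S G s D ->
    has_type S D A (U i) -> has_type S (cext D [] A) B (U i) ->
    tm_eq S G (sb (Sig A B) s) (Sig (sb A s) (sb B (lift [] s))) (U i)
| teq_pair_sb G D s A B t u i :
    sub S G s D ->
    has_type S D A (U i) -> has_type S (cext D [] A) B (U i) ->
    has_type S D t A -> has_type S D u (sb B (inst [] t)) ->
    tm_eq S G (sb (tpair t u) s) (tpair (sb t s) (sb u s)) (sb (Sig A B) s)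
| teq_pr1_sb G D s A B t i :
    sub S G s D ->
    has_type S D A (U i) -> has_type S (cext D [] A) B (U i) ->
    has_type S D t (Sig A B) ->
    tm_eq S G (sb (pr1 t) s) (pr1 (sb t s)) (sb A s)
| teq_pr2_sb G D s A B t i :
    sub S G s D ->
    has_type S D A (U i) -> has_type S (cext D [] A) B (U i) ->
    has_type S D t (Sig A B) ->
    tm_eq S G (sb (pr2 t) s) (pr2 (sb t s)) (sb (sb B (inst [] (pr1 t))) s)
| teq_Id_sb G D s A t u i :
    sub S G s D ->
    has_type S D A (U i) -> has_type S D t A -> has_type S D u A ->
    tm_eq S G (sb (Id A t u) s) (Id (sb A s) (sb t s) (sb u s)) (U i)
| teq_refl_sb G D s A t i :
    sub S G s D -> has_type S D A (U i) -> has_type S D t A ->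
    tm_eq S G (sb (trefl t) s) (trefl (sb t s)) (sb (Id A t t) s)
| teq_J_sb G D s A t u C d e i j :
    sub S G s D ->
    has_type S D A (U i) -> has_type S D t A -> has_type S D u A ->
    has_type S (cext (cext D [] A) [] (Id (up A) (up t) (v 0))) C (U j) ->
    has_type S D d (sb C (sext [] (inst [] t) (trefl t))) ->
    has_type S D e (Id A t u) ->
    tm_eq S G (sb (J C d e) s)
      (J (sb C (lift [] (lift [] s))) (sb d s) (sb e s))
      (sb (sb C (sext [] (inst [] u) e)) s)
| teq_Mod_sb G D s m A i :
    sub S G s D -> has_type S (clocks D m) A (U i) ->
    tm_eq S G (sb (Mod m A) s) (Mod m (sb A (slocks s m))) (U i)
| teq_mod_sb G D s m A t i :
    sub S G s D -> has_type S (clocks D m) A (U i) ->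
    has_type S (clocks D m) t A ->
    tm_eq S G (sb (mkmod m t) s) (mkmod m (sb t (slocks s m))) (sb (Mod m A) s)
| teq_letmod_sb G D s n m A C t u i j :
    sub S G s D ->
    has_type S (clocks D (n ++ m)) A (U i) ->
    has_type S (cext D n (Mod m A)) C (U j) ->
    has_type S (clocks D n) t (Mod m A) ->
    has_type S (cext D (n ++ m) A) u
      (sb C (sext n wk (mkmod m (var (n ++ m))))) ->
    tm_eq S G (sb (letmod n m C t u) s)
      (letmod n m (sb C (lift n s)) (sb t (slocks s n))
        (sb u (lift (n ++ m) s)))
      (sb (sb C (inst n t)) s)

| teq_sb G D s s' t t' A :
    sub_eq S G s s' D -> tm_eq S D t t' A ->
    tm_eq S G (sb t s) (sb t' s') (sb A s)
| teq_Pi G m A A' B B' i :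
    tm_eq S (clocks G m) A A' (U i) -> tm_eq S (cext G m A) B B' (U i) ->
    tm_eq S G (Pi m A B) (Pi m A' B') (U i)
| teq_lam G m A B t t' i :
    has_type S (clocks G m) A (U i) -> has_type S (cext G m A) B (U i) ->
    tm_eq S (cext G m A) t t' B ->
    tm_eq S G (lam m t) (lam m t') (Pi m A B)
| teq_app G m A B t t' u u' i :
    has_type S (clocks G m) A (U i) -> has_type S (cext G m A) B (U i) ->
    tm_eq S G t t' (Pi m A B) -> tm_eq S (clocks G m) u u' A ->
    tm_eq S G (tapp m t u) (tapp m t' u') (sb B (inst m u))
| teq_Sig G A A' B B' i :
    tm_eq S G A A' (U i) -> tm_eq S (cext G [] A) B B' (U i) ->
    tm_eq S G (Sig A B) (Sig A' B') (U i)
| teq_pair G A B t t' u u' i :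
    has_type S G A (U i) -> has_type S (cext G [] A) B (U i) ->
    tm_eq S G t t' A -> tm_eq S G u u' (sb B (inst [] t)) ->
    tm_eq S G (tpair t u) (tpair t' u') (Sig A B)
| teq_pr1 G A B t t' i :
    has_type S G A (U i) -> has_type S (cext G [] A) B (U i) ->
    tm_eq S G t t' (Sig A B) -> tm_eq S G (pr1 t) (pr1 t') A
| teq_pr2 G A B t t' i :
    has_type S G A (U i) -> has_type S (cext G [] A) B (U i) ->
    tm_eq S G t t' (Sig A B) ->
    tm_eq S G (pr2 t) (pr2 t') (sb B (inst [] (pr1 t)))
| teq_Id G A A' t t' u u' i :
    tm_eq S G A A' (U i) -> tm_eq S G t t' A -> tm_eq S G u u' A ->
    tm_eq S G (Id A t u) (Id A' t' u') (U i)
| teq_refl_cong G A t t' i :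
    has_type S G A (U i) -> tm_eq S G t t' A ->
    tm_eq S G (trefl t) (trefl t') (Id A t t)
| teq_J G A t u C C' d d' e e' i j :
    has_type S G A (U i) -> has_type S G t A -> has_type S G u A ->
    tm_eq S (cext (cext G [] A) [] (Id (up A) (up t) (v 0))) C C' (U j) ->
    tm_eq S G d d' (sb C (sext [] (inst [] t) (trefl t))) ->
    tm_eq S G e e' (Id A t u) ->
    tm_eq S G (J C d e) (J C' d' e') (sb C (sext [] (inst [] u) e))
| teq_Mod G m A A' i :
    ctx_ok S G -> tm_eq S (clocks G m) A A' (U i) ->
    tm_eq S G (Mod m A) (Mod m A') (U i)
| teq_mod G m A t t' i :
    ctx_ok S G -> has_type S (clocks G m) A (U i) ->
    tm_eq S (clocks G m) t t' A ->
    tm_eq S G (mkmod m t) (mkmod m t') (Mod m A)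
| teq_letmod G n m A C C' t t' u u' i j :
    has_type S (clocks G (n ++ m)) A (U i) ->
    tm_eq S (cext G n (Mod m A)) C C' (U j) ->
    tm_eq S (clocks G n) t t' (Mod m A) ->
    tm_eq S (cext G (n ++ m) A) u u'
      (sb C (sext n wk (mkmod m (var (n ++ m))))) ->
    tm_eq S G (letmod n m C t u) (letmod n m C' t' u') (sb C (inst n t))

with sub (S : signature) : Ctx S -> Su S -> Ctx S -> Prop :=
| sub_ctx G G' s D D' :
    ctx_eq S G G' -> ctx_eq S D D' -> sub S G s D -> sub S G' s D'
| sub_id G : ctx_ok S G -> sub S G sid G
| sub_comp G D E s r : sub S G r D -> sub S D s E -> sub S G (scomp s r) E
| sub_bang G : ctx_ok S G -> sub S G sbang cemp
| sub_wk G m A : ctx_ok S (cext G m A) -> sub S (cext G m A) wk G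
| sub_ext G D m s A t i :
    sub S G s D -> has_type S (clocks D m) A (U i) ->
    has_type S (clocks G m) t (sb A (slocks s m)) ->
    sub S G (sext m s t) (cext D m A)
| sub_lock G D g s : sub S G s D -> sub S (clock G g) (slock g s) (clock D g)
| sub_eta G : ctx_ok S G -> sub S (clock (clock G ga) gp) seta G
| sub_eps G : ctx_ok S G -> sub S G seps (clock (clock G gp) ga)
| sub_p2I G : ctx_ok S G -> sub S (clock G gp) sp2I (cext G [] (cst Int))
| sub_I2p G : ctx_ok S G -> sub S (cext G [] (cst Int)) sI2p (clock G gp)

with sub_eq (S : signature) : Ctx S -> Su S -> Su S -> Ctx S -> Prop :=
| seq_refl G s D : sub S G s D -> sub_eq S G s s D
| seq_sym G s r D : sub_eq S G s r D -> sub_eq S G r s D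
| seq_trans G s r q D : sub_eq S G s r D -> sub_eq S G r q D -> sub_eq S G s q D
| seq_ctx G G' s r D D' :
    ctx_eq S G G' -> ctx_eq S D D' -> sub_eq S G s r D -> sub_eq S G' s r D'
| seq_comp G D E s s' r r' :
    sub_eq S G r r' D -> sub_eq S D s s' E ->
    sub_eq S G (scomp s r) (scomp s' r') E
| seq_ext G D m s s' A t t' i :
    sub_eq S G s s' D -> has_type S (clocks D m) A (U i) ->
    tm_eq S (clocks G m) t t' (sb A (slocks s m)) ->
    sub_eq S G (sext m s t) (sext m s' t') (cext D m A)
| seq_lock G D g s s' :
    sub_eq S G s s' D -> sub_eq S (clock G g) (slock g s) (slock g s') (clock D g)
| seq_idl G D s : sub S G s D -> sub_eq S G (scomp sid s) s D
| seq_idr G D s : sub S G s D -> sub_eq S G (scomp s sid) s D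
| seq_assoc G D E F s r q :
    sub S G q D -> sub S D r E -> sub S E s F ->
    sub_eq S G (scomp (scomp s r) q) (scomp s (scomp r q)) F
| seq_bang G s : sub S G s cemp -> sub_eq S G s sbang cemp
| seq_wk_ext G D m s A t i :
    sub S G s D -> has_type S (clocks D m) A (U i) ->
    has_type S (clocks G m) t (sb A (slocks s m)) ->
    sub_eq S G (scomp wk (sext m s t)) s D
| seq_ext_eta G D m s A :
    ctx_ok S (cext D m A) -> sub S G s (cext D m A) ->
    sub_eq S G s (sext m (scomp wk s) (sb (var m) (slocks s m))) (cext D m A)
| seq_lock_id G g :
    ctx_ok S G -> sub_eq S (clock G g) (slock g sid) sid (clock G g)
| seq_lock_comp G D E g s r :
    sub S G r D -> sub S D s E ->
    sub_eq S (clock G g) (slock g (scomp s r)) (scomp (slock g s) (slock g r))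
      (clock E g)
| seq_eta_nat G D s :
    sub S G s D ->
    sub_eq S (clock (clock G ga) gp)
      (scomp seta (slock gp (slock ga s))) (scomp s seta) D
| seq_eps_nat G D s :
    sub S G s D ->
    sub_eq S G (scomp seps s) (scomp (slock ga (slock gp s)) seps)
      (clock (clock D gp) ga)
| seq_triangle_p G :
    ctx_ok S G ->
    sub_eq S (clock G gp) (scomp seta (slock gp seps)) sid (clock G gp)
| seq_triangle_a G :
    ctx_ok S G ->
    sub_eq S (clock G ga) (scomp (slock ga seta) seps) sid (clock G ga)
| seq_p2I_nat G D s :
    sub S G s D ->
    sub_eq S (clock G gp) (scomp sp2I (slock gp s)) (scomp (lift [] s) sp2I)
      (cext D [] (cst Int))
| seq_p2I_I2p G :
    ctx_ok S G ->
    sub_eq S (cext G [] (cst Int)) (scomp sp2I sI2p) sid (cext G [] (cst Int))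
| seq_I2p_p2I G :
    ctx_ok S G -> sub_eq S (clock G gp) (scomp sI2p sp2I) sid (clock G gp).

(* Main.v *)
(* Over [G.(x : I -> X).(i : I)] the second projection of [F (x i)] says that
   [F0 (x i)] is amazingly covariant.  Moving it across [sp2I] into the context
   locked by [gp] and transposing along the adjunction gives, over
   [G.(x : I -> X)], a proof that [i |-> F0 (x i)] is covariant over I: the
   triangle identity for [gp] cancels the unit hidden in [isAmazinglyCov] against
   the counit.  Covariance of that family at the identity arrow of I is
   judgementally covariance of [F0] at [x], because both only depend on the
   composite family over I. *)
Require Import Defs.
From Stdlib Require Import List Lia.
Import ListNotations.

(** Explicit substitutions never reduce on the nose: even [up (Sig A B)] is a suspended substitution
    and not a Sigma type. Calculations are therefore carried out as relations along a substitution,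
    whose right-hand side is a chosen reduct of the substituted left-hand side.

    Opening [Mod [ga]] directly over a context ending in [i : I] would leave a variable usable only
    under a lock [ga]. The counit removes locks only as the pair [gp], [ga], so the opening has to
    happen beneath a lock [gp]; this forces the detour through [sp2I]. The computation is done once,
    for the generic code [v 0] over a context extended by a universe. A concrete type over [G.I] is
    then a substitution into that context, and transposing the type becomes transposing the
    substitution, for which the triangle identity is directly an equation.

    The outcome concerns a family with base I, the goal one with base [X], and these two bases are
    unrelated. Hence covariance is compared one arrow at a time, by an equality of families along
    arrows that ignores the base. *)

Section Calculus.
Context {Sg : signature}.
Implicit Types (G D E : Ctx Sg) (A B X t u a x : Tm Sg) (s r : Su Sg).

(** * Universe levels and well-formed substitutions *)

Lemma ty_le G A m n : m <= n -> has_type Sg G A (U m) -> has_type Sg G A (U n).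
Proof. induction 1; eauto using ty_cumul. Qed.

Lemma teq_le G A B m n : m <= n -> tm_eq Sg G A B (U m) -> tm_eq Sg G A B (U n).
Proof. induction 1; eauto using teq_cumul. Qed.

Lemma teq_U_conv G D s n t u :
  sub Sg G s D -> tm_eq Sg G t u (sb (U n) s) -> tm_eq Sg G t u (U n).
Proof. intros; eapply teq_conv; [eassumption | eapply teq_U_sb; eassumption]. Qed.

Lemma ty_sb_U G D s A n :
  sub Sg G s D -> has_type Sg D A (U n) -> has_type Sg G (sb A s) (U n).
Proof.
  intros; eapply ty_conv; [eapply ty_sb; eassumption | eapply teq_U_sb; eassumption].
Qed.

Lemma teq_sb_U G D s r A B n :
  sub_eq Sg G s r D -> sub Sg G s D -> tm_eq Sg D A B (U n) ->
  tm_eq Sg G (sb A s) (sb B r) (U n).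
Proof. intros; eapply teq_U_conv; [eassumption | eapply teq_sb; eassumption]. Qed.

Lemma teq_sb_comp_U G D E s r A n :
  sub Sg G r D -> sub Sg D s E -> has_type Sg E A (U n) ->
  tm_eq Sg G (sb (sb A s) r) (sb A (scomp s r)) (U n).
Proof.
  intros; eapply teq_U_conv; [| eapply teq_sb_comp; eassumption].
  eapply sub_comp; eassumption.
Qed.

Lemma ty_v0 G A : ctx_ok Sg (cext G [] A) -> has_type Sg (cext G [] A) (v 0) (up A).
Proof. exact (ty_var Sg G [] A). Qed.

Lemma ty_Int G : ctx_ok Sg G -> has_type Sg G (cst Int) (U 0).
Proof.
  intros HG; eapply ty_conv; [eapply ty_cst with (c := Int) (i := 1) |].
  - exact HG.
  - simpl; apply ty_U, ok_emp.
  - simpl; eapply teq_U_sb, sub_bang, HG.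
Qed.

Lemma teq_Int_sb_U G D s :
  ctx_ok Sg G -> sub Sg G s D -> tm_eq Sg G (sb (cst Int) s) (cst Int) (U 0).
Proof.
  intros; eapply teq_U_conv; [apply sub_bang; assumption |].
  eapply (teq_cst_sb Sg G D s Int 1); [assumption | apply ty_U, ok_emp].
Qed.

(** Carries the well-formedness of both contexts, which [sub] alone would give back only after an
    induction over all the mutual judgements. *)
Record wsub G s D : Prop := WSub {
  ws_dom : ctx_ok Sg G;
  ws_cod : ctx_ok Sg D;
  ws_sub : sub Sg G s D }.

Lemma wsub_id G : ctx_ok Sg G -> wsub G sid G.
Proof. intros; constructor; auto using sub_id. Qed.

Lemma wsub_comp G D E s r : wsub D s E -> wsub G r D -> wsub G (scomp s r) E.
Proof. intros [] []; constructor; eauto using sub_comp. Qed.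

Lemma wsub_wk G m A : ctx_ok Sg (cext G m A) -> wsub (cext G m A) wk G.
Proof.
  intros H; constructor; [assumption | inversion H; assumption | auto using sub_wk].
Qed.

Lemma wsub_ext G D s A t n :
  wsub G s D -> has_type Sg D A (U n) -> has_type Sg G t (sb A s) ->
  wsub G (sext [] s t) (cext D [] A).
Proof.
  intros [? ? Hs] HA Ht; constructor; [assumption | eapply ok_ext; eauto |].
  eapply sub_ext; eauto.
Qed.

Lemma wk_sext G D s A t n :
  wsub G s D -> has_type Sg D A (U n) -> has_type Sg G t (sb A s) ->
  sub_eq Sg G (scomp wk (sext [] s t)) s D.
Proof. intros [] HA Ht; eapply seq_wk_ext; eauto. Qed.

Lemma v0_sext G D s A t n :
  wsub G s D -> has_type Sg D A (U n) -> has_type Sg G t (sb A s) ->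
  tm_eq Sg G (sb (v 0) (sext [] s t)) t (sb A s).
Proof. intros [] HA Ht; exact (teq_var_sb Sg G D [] s A t n ltac:(assumption) HA Ht). Qed.

(** By the eta rule a substitution into an extended context is determined by its weakening and its
    last variable, and the two sides agree on both. *)
Lemma sext_comp G D E s r A t n :
  wsub G r D -> wsub D s E -> has_type Sg E A (U n) ->
  has_type Sg D t (sb A s) ->
  sub_eq Sg G (scomp (sext [] s t) r) (sext [] (scomp s r) (sb t r)) (cext E [] A).
Proof.
  intros Hr Hs HA Ht.
  pose proof (wsub_ext _ _ _ _ _ _ Hs HA Ht) as Hst.
  pose proof (wsub_comp _ _ _ _ _ Hst Hr) as Hq.
  pose proof (wsub_wk _ _ _ (ws_cod _ _ _ Hst)) as Hwk.
  assert (Htr : has_type Sg G (sb t r) (sb A (scomp s r))).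
  { eapply ty_conv; [eapply ty_sb; [apply Hr | exact Ht] |].
    eapply teq_sb_comp_U; [apply Hr | apply Hs | exact HA]. }
  eapply seq_trans.
  { eapply seq_ext_eta; [apply Hst | apply Hq]. }
  apply seq_sym. eapply seq_ext with (i := n); [| exact HA |]; simpl.
  - apply seq_sym. eapply seq_trans.
    + apply seq_sym. eapply seq_assoc; [apply Hr | apply Hst | apply Hwk].
    + eapply seq_comp; [apply seq_refl, Hr | eapply wk_sext; eauto].
  - apply teq_sym. eapply teq_trans.
    + apply teq_sym. eapply teq_conv.
      * eapply teq_sb_comp; [apply Hr | apply Hst | apply ty_v0, Hst].
      * eapply teq_trans.
        -- eapply teq_sb_comp_U; [apply Hq | apply Hwk | exact HA].
        -- eapply teq_sb_U; [| apply (wsub_comp _ _ _ _ _ Hwk Hq) | apply teq_refl; exact HA].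
           eapply seq_trans.
           ++ apply seq_sym. eapply seq_assoc; [apply Hr | apply Hst | apply Hwk].
           ++ eapply seq_comp; [apply seq_refl, Hr | eapply wk_sext; eauto].
    + eapply teq_conv.
      * eapply teq_sb; [apply seq_refl, Hr | eapply v0_sext; eauto].
      * eapply teq_sb_comp_U; [apply Hr | apply Hs | exact HA].
Qed.

(** * Types and terms related along a substitution *)

Section Level.
Variable N : nat.

(* The typings of both sides are bundled with the equation, since no
   presupposition lemma is available for the judgemental equalities.  All types
   are compared in one universe [U N], which cumulativity makes harmless. *)
Record tyR G s D A A' : Prop := TyR {
  tyR_sub : wsub G s D;
  tyR_l : has_type Sg D A (U N);
  tyR_r : has_type Sg G A' (U N);
  tyR_eq : tm_eq Sg G (sb A s) A' (U N) }.

Record tmR G s D t t' A A' : Prop := TmR {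
  tmR_ty : tyR G s D A A';
  tmR_l : has_type Sg D t A;
  tmR_r : has_type Sg G t' A';
  tmR_eq : tm_eq Sg G (sb t s) t' A' }.

Lemma tyR_sb G s D A : wsub G s D -> has_type Sg D A (U N) -> tyR G s D A (sb A s).
Proof.
  intros H HA; constructor; auto.
  - eapply ty_sb_U; [apply H | exact HA].
  - apply teq_refl; eapply ty_sb_U; [apply H | exact HA].
Qed.

Lemma tmR_sb G s D t A :
  wsub G s D -> has_type Sg D A (U N) -> has_type Sg D t A ->
  tmR G s D t (sb t s) A (sb A s).
Proof.
  intros H HA Ht; constructor; auto using tyR_sb.
  - eapply ty_sb; [apply H | exact Ht].
  - apply teq_refl; eapply ty_sb; [apply H | exact Ht].
Qed.

Lemma tyR_convr G s D A A' B :
  tyR G s D A A' -> has_type Sg G B (U N) -> tm_eq Sg G A' B (U N) -> tyR G s D A B.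
Proof. intros [] HB H; constructor; eauto using teq_trans. Qed.

Lemma tyR_convl G s D A A' B :
  tyR G s D A A' -> has_type Sg D B (U N) -> tm_eq Sg D A B (U N) -> tyR G s D B A'.
Proof.
  intros [Hs HA HA' H] HB HAB; constructor; auto.
  eapply teq_trans; [| exact H]. apply teq_sym.
  eapply teq_sb_U; [apply seq_refl, Hs | apply Hs | exact HAB].
Qed.

Lemma tyR_fun G s D A A' A'' :
  tyR G s D A A' -> tyR G s D A A'' -> tm_eq Sg G A' A'' (U N).
Proof. intros [] []; eauto using teq_trans, teq_sym. Qed.

(** An equation over [D] suffices: [A'] and [B'] are the substituted [A] and [B] up to equality, so
    the equation over [G] follows. *)
Lemma tmR_conv G s D t t' A A' B B' :
  tmR G s D t t' A A' -> tyR G s D B B' -> tm_eq Sg D A B (U N) ->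
  tmR G s D t t' B B'.
Proof.
  intros [HA Ht Ht' H] HB HAB.
  assert (HAB' : tm_eq Sg G A' B' (U N)).
  { eapply tyR_fun; [exact HA |].
    eapply tyR_convl; [exact HB | apply HA | apply teq_sym, HAB]. }
  constructor; auto; eauto using ty_conv, teq_conv.
Qed.

Lemma tmR_convr G s D t t' A A' B' :
  tmR G s D t t' A A' -> tyR G s D A B' -> tmR G s D t t' A B'.
Proof.
  intros H HB; eapply tmR_conv; [exact H | exact HB | apply teq_refl, HB].
Qed.

Lemma tmR_fun G s D t t' t'' A A' A'' :
  tmR G s D t t' A A' -> tmR G s D t t'' A A'' -> tm_eq Sg G t' t'' A'.
Proof.
  intros H1 H2; eapply tmR_convr with (B' := A') in H2; [| apply H1].
  destruct H1, H2; eauto using teq_trans, teq_sym.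
Qed.

Lemma tyR_id G A : ctx_ok Sg G -> has_type Sg G A (U N) -> tyR G sid G A A.
Proof. intros; constructor; auto using wsub_id, teq_sb_id. Qed.

Lemma tmR_id G t A :
  ctx_ok Sg G -> has_type Sg G A (U N) -> has_type Sg G t A -> tmR G sid G t t A A.
Proof. intros; constructor; auto using tyR_id, teq_sb_id. Qed.

Lemma tyR_comp G D E s r A A' A'' :
  tyR D s E A A' -> tyR G r D A' A'' -> tyR G (scomp s r) E A A''.
Proof.
  intros [Hs HA HA' H] [Hr _ HA'' H']; constructor; eauto using wsub_comp.
  eapply teq_trans.
  - apply teq_sym; eapply teq_sb_comp_U; [apply Hr | apply Hs | exact HA].
  - eapply teq_trans; [| exact H'].
    eapply teq_sb_U; [apply seq_refl, Hr | apply Hr | exact H].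
Qed.

Lemma tmR_comp G D E s r t t' t'' A A' A'' :
  tmR D s E t t' A A' -> tmR G r D t' t'' A' A'' -> tmR G (scomp s r) E t t'' A A''.
Proof.
  intros [HA Ht Ht' H] [HA' _ Ht'' H'].
  pose proof (tyR_comp _ _ _ _ _ _ _ _ HA HA') as HAA.
  destruct (tyR_sub _ _ _ _ _ HA) as [? ? Hs], (tyR_sub _ _ _ _ _ HA') as [? ? Hr].
  constructor; auto.
  eapply teq_trans; [apply teq_sym; eapply teq_conv |].
  - eapply teq_sb_comp; [exact Hr | exact Hs | exact Ht].
  - apply HAA.
  - eapply teq_trans; [| exact H']. eapply teq_conv; [| apply HA'].
    eapply teq_sb; [apply seq_refl, Hr | exact H].
Qed.

Lemma tyR_seq G s r D A A' :
  tyR G s D A A' -> wsub G r D -> sub_eq Sg G r s D -> tyR G r D A A'.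
Proof.
  intros [Hs HA HA' H] Hr Hrs; constructor; auto.
  eapply teq_trans; [| exact H].
  eapply teq_sb_U; [exact Hrs | apply Hr | apply teq_refl, HA].
Qed.

Lemma tmR_seq G s r D t t' A A' :
  tmR G s D t t' A A' -> wsub G r D -> sub_eq Sg G r s D -> tmR G r D t t' A A'.
Proof.
  intros [HA Ht Ht' H] Hr Hrs.
  pose proof (tyR_seq _ _ _ _ _ _ HA Hr Hrs) as HA2; constructor; auto.
  eapply teq_trans; [| exact H]. eapply teq_conv; [| apply HA2].
  eapply teq_sb; [exact Hrs | apply teq_refl, Ht].
Qed.

Lemma tyR_up G A B :
  ctx_ok Sg (cext G [] B) -> has_type Sg G A (U N) -> tyR (cext G [] B) wk G A (up A).
Proof. intros; apply tyR_sb; auto using wsub_wk. Qed.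

Lemma tmR_up G t A B :
  ctx_ok Sg (cext G [] B) -> has_type Sg G A (U N) -> has_type Sg G t A ->
  tmR (cext G [] B) wk G t (up t) A (up A).
Proof. intros; apply tmR_sb; auto using wsub_wk. Qed.

Lemma wsub_sext G s D u B B' :
  tyR G s D B B' -> has_type Sg G u B' -> wsub G (sext [] s u) (cext D [] B).
Proof.
  intros HB Hu; eapply wsub_ext; [apply HB | apply HB |].
  eapply ty_conv; [exact Hu | apply teq_sym, HB].
Qed.

Lemma seq_wk_sext G s D u B B' :
  tyR G s D B B' -> has_type Sg G u B' -> sub_eq Sg G (scomp wk (sext [] s u)) s D.
Proof.
  intros HB Hu; eapply wk_sext; [apply HB | apply HB |].
  eapply ty_conv; [exact Hu | apply teq_sym, HB].
Qed.

(** The weakening hidden in [up] cancels against the extension. The case [s := sid] computes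
    instantiations, and the case of [s] composed with [wk] computes lifts. *)
Lemma tyR_up_sext G s D u A A' B B' :
  tyR G s D B B' -> has_type Sg G u B' -> tyR G s D A A' ->
  tyR G (sext [] s u) (cext D [] B) (up A) A'.
Proof.
  intros HB Hu HA.
  pose proof (wsub_sext _ _ _ _ _ _ HB Hu) as Hs.
  pose proof (wsub_wk _ _ _ (ws_cod _ _ _ Hs)) as Hwk.
  assert (HA2 : tyR G (scomp wk (sext [] s u)) D A A').
  { eapply tyR_seq; [exact HA | eapply wsub_comp; [exact Hwk | exact Hs] |].
    eapply seq_wk_sext; [exact HB | exact Hu]. }
  constructor; [exact Hs | | apply HA |].
  - eapply ty_sb_U; [apply Hwk | apply HA].
  - eapply teq_trans; [| apply HA2].
    eapply teq_sb_comp_U; [apply Hs | apply Hwk | apply HA].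
Qed.

Lemma tmR_up_sext G s D u t t' A A' B B' :
  tyR G s D B B' -> has_type Sg G u B' -> tmR G s D t t' A A' ->
  tmR G (sext [] s u) (cext D [] B) (up t) t' (up A) A'.
Proof.
  intros HB Hu Ht.
  pose proof (wsub_sext _ _ _ _ _ _ HB Hu) as Hs.
  pose proof (wsub_wk _ _ _ (ws_cod _ _ _ Hs)) as Hwk.
  assert (Ht2 : tmR G (scomp wk (sext [] s u)) D t t' A A').
  { eapply tmR_seq; [exact Ht | eapply wsub_comp; [exact Hwk | exact Hs] |].
    eapply seq_wk_sext; [exact HB | exact Hu]. }
  constructor.
  - eapply tyR_up_sext; eauto. apply Ht.
  - eapply ty_sb; [apply Hwk | apply Ht].
  - apply Ht.
  - eapply teq_trans; [| apply Ht2]. eapply teq_conv; [| apply Ht2].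
    eapply teq_sb_comp; [apply Hs | apply Hwk | apply Ht].
Qed.

Lemma tmR_v0_sext G s D u B B' :
  tyR G s D B B' -> has_type Sg G u B' ->
  tmR G (sext [] s u) (cext D [] B) (v 0) u (up B) B'.
Proof.
  intros HB Hu; pose proof (wsub_sext _ _ _ _ _ _ HB Hu) as Hs; constructor.
  - eapply tyR_up_sext; eauto.
  - apply ty_v0, Hs.
  - exact Hu.
  - eapply teq_conv; [| apply HB].
    eapply v0_sext; [apply HB | apply HB |].
    eapply ty_conv; [exact Hu | apply teq_sym, HB].
Qed.

Lemma ok_extN G A : ctx_ok Sg G -> has_type Sg G A (U N) -> ctx_ok Sg (cext G [] A).
Proof. intros; eapply ok_ext; eauto. Qed.

Lemma tyR_wkr G s D A A' B :
  tyR G s D A A' -> ctx_ok Sg (cext G [] B) ->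
  tyR (cext G [] B) (scomp s wk) D A (up A').
Proof. intros HA HB; eapply tyR_comp; [exact HA | apply tyR_up; auto; apply HA]. Qed.

Lemma tmR_wkr G s D t t' A A' B :
  tmR G s D t t' A A' -> ctx_ok Sg (cext G [] B) ->
  tmR (cext G [] B) (scomp s wk) D t (up t') A (up A').
Proof.
  intros Ht HB; eapply tmR_comp; [exact Ht | apply tmR_up; auto; apply Ht].
Qed.

Lemma tyR_okr G s D A A' : tyR G s D A A' -> ctx_ok Sg (cext G [] A').
Proof. intros H; eapply ok_ext; [apply H | apply H]. Qed.

Lemma tyR_okl G s D A A' : tyR G s D A A' -> ctx_ok Sg (cext D [] A).
Proof. intros H; eapply ok_ext; [apply H | apply H]. Qed.

Lemma tyR_lift G s D A A' B B' :
  tyR G s D B B' -> tyR G s D A A' ->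
  tyR (cext G [] B') (lift [] s) (cext D [] B) (up A) (up A').
Proof.
  intros HB HA; eapply tyR_up_sext.
  - apply tyR_wkr; [exact HB | eapply tyR_okr, HB].
  - eapply ty_v0, tyR_okr, HB.
  - apply tyR_wkr; [exact HA | eapply tyR_okr, HB].
Qed.

Lemma tmR_lift G s D t t' A A' B B' :
  tyR G s D B B' -> tmR G s D t t' A A' ->
  tmR (cext G [] B') (lift [] s) (cext D [] B) (up t) (up t') (up A) (up A').
Proof.
  intros HB Ht; eapply tmR_up_sext.
  - apply tyR_wkr; [exact HB | eapply tyR_okr, HB].
  - eapply ty_v0, tyR_okr, HB.
  - apply tmR_wkr; [exact Ht | eapply tyR_okr, HB].
Qed.

Lemma tmR_v0 G s D B B' :
  tyR G s D B B' ->
  tmR (cext G [] B') (lift [] s) (cext D [] B) (v 0) (v 0) (up B) (up B').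
Proof.
  intros HB; eapply tmR_v0_sext.
  - apply tyR_wkr; [exact HB | eapply tyR_okr, HB].
  - eapply ty_v0, tyR_okr, HB.
Qed.

Lemma wsub_lift G s D B B' :
  tyR G s D B B' -> wsub (cext G [] B') (lift [] s) (cext D [] B).
Proof. intros HB; eapply tyR_sub, tyR_lift; eauto. Qed.

(** * Compatibility of the relations with the type and term formers *)

Lemma tyR_Pi G s D A A' B B' :
  tyR G s D A A' -> tyR (cext G [] A') (lift [] s) (cext D [] A) B B' ->
  tyR G s D (Pi [] A B) (Pi [] A' B').
Proof.
  intros [Hs HA HA' H] [_ HB HB' H']; constructor; auto.
  - eapply ty_Pi; eauto.
  - eapply ty_Pi; eauto.
  - eapply teq_trans; [eapply teq_Pi_sb; [apply Hs | exact HA | exact HB] |].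
    (* The congruence rule compares codomains over its left-hand domain. Reading it backwards makes
       that domain [A'], where the equation for the codomains is given, and avoids a context
       conversion. *)
    apply teq_sym, teq_Pi; simpl; apply teq_sym; assumption.
Qed.

Lemma tyR_Sig G s D A A' B B' :
  tyR G s D A A' -> tyR (cext G [] A') (lift [] s) (cext D [] A) B B' ->
  tyR G s D (Sig A B) (Sig A' B').
Proof.
  intros [Hs HA HA' H] [_ HB HB' H']; constructor; auto.
  - eapply ty_Sig; eauto.
  - eapply ty_Sig; eauto.
  - eapply teq_trans; [eapply teq_Sig_sb; [apply Hs | exact HA | exact HB] |].
    apply teq_sym, teq_Sig; apply teq_sym; assumption.
Qed.

Lemma tyR_Id G s D A A' t t' u u' :
  tmR G s D t t' A A' -> tmR G s D u u' A A' -> tyR G s D (Id A t u) (Id A' t' u').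
Proof.
  intros [HA Ht Ht' H] [_ Hu Hu' H']; destruct HA as [Hs HA HA' HE]; constructor; auto.
  - eapply ty_Id; eauto.
  - eapply ty_Id; eauto.
  - eapply teq_trans; [eapply teq_Id_sb; [apply Hs | exact HA | exact Ht | exact Hu] |].
    apply teq_sym, teq_Id; apply teq_sym; assumption.
Qed.

(** Instantiating after the lift cancels the weakening inside [lift] and sends the last variable to
    [u]. This reduces an extension to the shape in which relations under a binder are available. *)
Lemma lift_inst G s D A A' u :
  tyR G s D A A' -> has_type Sg G u A' ->
  sub_eq Sg G (sext [] s u) (scomp (lift [] s) (inst [] u)) (cext D [] A).
Proof.
  intros HA Hu.
  assert (IG : wsub G (inst [] u) (cext G [] A')).
  { eapply wsub_sext; [apply tyR_id; apply HA | exact Hu]. }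
  apply seq_sym. eapply seq_trans.
  - eapply sext_comp with (n := N); [exact IG | | apply HA |].
    + eapply wsub_comp; [apply HA | apply wsub_wk, IG].
    + eapply ty_conv; [apply ty_v0, IG |].
      apply teq_sym, (tyR_wkr _ _ _ _ _ A' HA), IG.
  - apply seq_sym. eapply seq_ext with (i := N); [| apply HA |]; simpl.
    + apply seq_sym. eapply seq_trans.
      * eapply seq_assoc; [apply IG | apply wsub_wk, IG | apply HA].
      * eapply seq_trans; [| eapply seq_idr; apply HA].
        eapply seq_comp; [| apply seq_refl, HA].
        eapply seq_wk_sext; [apply tyR_id; apply HA | exact Hu].
    + apply teq_sym. eapply teq_conv; [| apply teq_sym, HA].
      eapply tmR_v0_sext; [apply tyR_id; apply HA | exact Hu].
Qed.

(** Instantiating and then applying [s], or lifting [s] and then instantiating, both amount to the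
    single extension [sext [] s u']. *)
Lemma tyR_inst G s D A A' B B' u u' :
  tyR (cext G [] A') (lift [] s) (cext D [] A) B B' -> tmR G s D u u' A A' ->
  tyR G s D (sb B (inst [] u)) (sb B' (inst [] u')).
Proof.
  intros HB Hu; pose proof (tmR_ty _ _ _ _ _ _ _ Hu) as HA.
  assert (IG : wsub G (inst [] u') (cext G [] A')).
  { eapply wsub_sext; [apply tyR_id; apply HA | apply Hu]. }
  assert (ID : wsub D (inst [] u) (cext D [] A)).
  { eapply wsub_sext; [apply tyR_id; apply HA | apply Hu]. }
  assert (Hm : wsub G (sext [] s u') (cext D [] A)).
  { eapply wsub_sext; [exact HA | apply Hu]. }
  pose proof (tyR_comp _ _ _ _ _ _ _ _ HB
    (tyR_sb _ _ _ _ IG (tyR_r _ _ _ _ _ HB))) as H1.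
  pose proof (lift_inst _ _ _ _ _ _ HA (tmR_r _ _ _ _ _ _ _ Hu)) as E1.
  assert (E2 : sub_eq Sg G (scomp (inst [] u) s) (sext [] s u') (cext D [] A)).
  { eapply seq_trans.
    - eapply sext_comp with (n := N); [apply HA | apply wsub_id, HA | apply HA |].
      eapply ty_conv; [apply Hu | apply teq_sym, teq_sb_id, HA].
    - apply seq_sym. eapply seq_ext with (i := N); [| apply HA |]; simpl.
      + apply seq_sym. eapply seq_idl, HA.
      + apply teq_sym. eapply teq_conv; [apply Hu | apply teq_sym, HA]. }
  assert (H2 : tyR G (scomp (inst [] u) s) (cext D [] A) B (sb B' (inst [] u'))).
  { eapply tyR_seq; [exact H1 | | eapply seq_trans; eassumption].
    eapply wsub_comp; [exact ID | apply HA]. }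
  constructor; [apply HA | | apply H2 |].
  - eapply ty_sb_U; [apply ID | apply HB].
  - eapply teq_trans; [| apply H2].
    eapply teq_sb_comp_U; [apply HA | apply ID | apply HB].
Qed.

Lemma tmR_app G s D A A' B B' t t' u u' :
  tyR (cext G [] A') (lift [] s) (cext D [] A) B B' ->
  tmR G s D t t' (Pi [] A B) (Pi [] A' B') -> tmR G s D u u' A A' ->
  tmR G s D (ap t u) (ap t' u') (sb B (inst [] u)) (sb B' (inst [] u')).
Proof.
  intros HB Ht Hu; pose proof (tyR_inst _ _ _ _ _ _ _ _ _ HB Hu) as HBu.
  pose proof (tmR_ty _ _ _ _ _ _ _ Hu) as HA.
  constructor; [exact HBu | | |].
  - eapply ty_app; [apply HA | apply HB | apply Ht | apply Hu].
  - eapply ty_app; [apply HA | apply HB | apply Ht | apply Hu].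
  - eapply teq_trans.
    + eapply teq_conv; [| apply HBu].
      eapply teq_app_sb; [apply HA | apply HA | apply HB | apply Ht | apply Hu].
    + apply teq_sym. eapply teq_app; [apply HA | apply HB | |]; apply teq_sym;
        [apply Ht | apply Hu].
Qed.

Lemma tyR_arr G s D A A' B B' :
  tyR G s D A A' -> tyR G s D B B' -> tyR G s D (arr A B) (arr A' B').
Proof. intros; apply tyR_Pi; auto using tyR_lift. Qed.

Lemma teq_up_inst G A B u :
  ctx_ok Sg G -> has_type Sg G A (U N) -> has_type Sg G B (U N) -> has_type Sg G u A ->
  tm_eq Sg G (sb (up B) (inst [] u)) B (U N).
Proof.
  intros HG HA HB Hu; eapply tyR_eq, tyR_up_sext.
  - apply tyR_id; [exact HG | exact HA].
  - exact Hu.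
  - apply tyR_id; assumption.
Qed.

Lemma tmR_apN G s D A A' B B' t t' u u' :
  tyR G s D B B' ->
  tmR G s D t t' (arr A B) (arr A' B') -> tmR G s D u u' A A' ->
  tmR G s D (ap t u) (ap t' u') B B'.
Proof.
  intros HB Ht Hu; pose proof (tmR_ty _ _ _ _ _ _ _ Hu) as HA.
  eapply tmR_conv; [eapply tmR_app; [| exact Ht | exact Hu] | exact HB |].
  - apply tyR_lift; assumption.
  - eapply teq_up_inst; [apply HA | apply HA | apply HB | apply Hu].
Qed.

Lemma tmR_lam G s D A A' B B' t t' :
  tyR G s D A A' -> tmR (cext G [] A') (lift [] s) (cext D [] A) t t' B B' ->
  tmR G s D (lam [] t) (lam [] t') (Pi [] A B) (Pi [] A' B').
Proof.
  intros HA Ht; pose proof (tmR_ty _ _ _ _ _ _ _ Ht) as HB.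
  pose proof (tyR_Pi _ _ _ _ _ _ _ HA HB) as HP.
  constructor; [exact HP | | |].
  - eapply ty_lam; [apply HA | apply HB | apply Ht].
  - eapply ty_lam; [apply HA | apply HB | apply Ht].
  - eapply teq_trans.
    + eapply teq_conv; [| apply HP].
      eapply teq_lam_sb; [apply HA | apply HA | apply HB | apply Ht].
    + apply teq_sym. eapply teq_lam; [apply HA | apply HB | apply teq_sym, Ht].
Qed.

Lemma tmR_pr1 G s D A A' B B' t t' :
  tyR G s D A A' -> tyR (cext G [] A') (lift [] s) (cext D [] A) B B' ->
  tmR G s D t t' (Sig A B) (Sig A' B') ->
  tmR G s D (pr1 t) (pr1 t') A A'.
Proof.
  intros HA HB Ht; constructor; [exact HA | | |].
  - eapply ty_pr1; [apply HA | apply HB | apply Ht].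
  - eapply ty_pr1; [apply HA | apply HB | apply Ht].
  - eapply teq_trans.
    + eapply teq_conv; [| apply HA].
      eapply teq_pr1_sb; [apply HA | apply HA | apply HB | apply Ht].
    + eapply teq_pr1; [apply HA | apply HB | apply Ht].
Qed.

Lemma tyR_Int G s D : wsub G s D -> tyR G s D (cst Int) (cst Int).
Proof.
  intros Hs; constructor; [exact Hs | | |].
  - apply ty_le with 0; [lia | apply ty_Int, Hs].
  - apply ty_le with 0; [lia | apply ty_Int, Hs].
  - apply teq_le with 0; [lia | eapply teq_Int_sb_U; apply Hs].
Qed.

Lemma tyR_U G s D n : n < N -> wsub G s D -> tyR G s D (U n) (U n).
Proof.
  intros Hn Hs; constructor; [exact Hs | | |].
  - apply ty_le with (S n); [lia | apply ty_U, Hs].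
  - apply ty_le with (S n); [lia | apply ty_U, Hs].
  - apply teq_le with (S n); [lia | eapply teq_U_sb; apply Hs].
Qed.

Lemma tmR_endpoint G s D c :
  const_type Sg c = cst Int -> wsub G s D -> tmR G s D (cst c) (cst c) (cst Int) (cst Int).
Proof.
  intros Hc Hs.
  assert (Hty : has_type Sg cemp (const_type Sg c) (U 0)).
  { rewrite Hc; apply ty_Int, ok_emp. }
  assert (HI : forall E, ctx_ok Sg E ->
    tm_eq Sg E (sb (const_type Sg c) sbang) (cst Int) (U 0)).
  { intros E HE; rewrite Hc; eapply teq_Int_sb_U; [exact HE | apply sub_bang, HE]. }
  constructor; [apply tyR_Int, Hs | | |].
  - eapply ty_conv; [eapply ty_cst; [apply Hs | exact Hty] | apply HI, Hs].
  - eapply ty_conv; [eapply ty_cst; [apply Hs | exact Hty] | apply HI, Hs].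
  - eapply teq_conv; [eapply teq_cst_sb; [apply Hs | exact Hty] | apply HI, Hs].
Qed.

Lemma tmR_i0 G s D : wsub G s D -> tmR G s D i0 i0 (cst Int) (cst Int).
Proof. now apply tmR_endpoint. Qed.

Lemma tmR_i1 G s D : wsub G s D -> tmR G s D i1 i1 (cst Int) (cst Int).
Proof. now apply tmR_endpoint. Qed.

Lemma tyR_isContr G s D A A' : tyR G s D A A' -> tyR G s D (isContr A) (isContr A').
Proof.
  intros HA. pose proof (tyR_lift _ _ _ _ _ _ _ HA HA) as HA1.
  apply tyR_Sig; [exact HA |]. apply tyR_Pi; [exact HA1 |]. apply tyR_Id.
  - apply (tmR_lift _ _ _ _ _ _ _ _ _ HA1), tmR_v0, HA.
  - apply tmR_v0, HA1.
Qed.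

(** * Families pulled back along arrows of the interval *)

Section Families.
Variable k : nat.
Hypothesis k_lt_N : k < N.

Definition at_fam A x t : Tm Sg := ap A (ap x t).

(** The pullback of [A] along [x], evaluated at the generic point of I; its instances recover every
    [at_fam A x t]. *)
Definition fam_body A x : Tm Sg := at_fam (up A) (up x) (v 0).

Record fam G X A x : Prop := Fam {
  fam_ok : ctx_ok Sg G;
  fam_base : has_type Sg G X (U N);
  fam_ty : has_type Sg G A (arr X (U k));
  fam_arrow : has_type Sg G x (arr (cst Int) X) }.

Record famR G s D X X' A A' x x' : Prop := FamR {
  famR_base : tyR G s D X X';
  famR_ty : tmR G s D A A' (arr X (U k)) (arr X' (U k));
  famR_arrow : tmR G s D x x' (arr (cst Int) X) (arr (cst Int) X') }.

Lemma famR_l G s D X X' A A' x x' : famR G s D X X' A A' x x' -> fam D X A x.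
Proof. intros [HX HA Hx]; constructor; [apply HX | apply HX | apply HA | apply Hx]. Qed.

Lemma famR_r G s D X X' A A' x x' : famR G s D X X' A A' x x' -> fam G X' A' x'.
Proof. intros [HX HA Hx]; constructor; [apply HX | apply HX | apply HA | apply Hx]. Qed.

Lemma famR_at_tm G s D X X' A A' x x' t t' :
  famR G s D X X' A A' x x' -> tmR G s D t t' (cst Int) (cst Int) ->
  tmR G s D (at_fam A x t) (at_fam A' x' t') (U k) (U k).
Proof.
  intros [HX HA Hx] Ht; eapply tmR_apN; [| exact HA |].
  - apply tyR_U; [exact k_lt_N | apply HX].
  - eapply tmR_apN; [exact HX | exact Hx | exact Ht].
Qed.

Lemma tyR_of_tmR_U G s D A A' : tmR G s D A A' (U k) (U k) -> tyR G s D A A'.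
Proof.
  intros HA; constructor; [apply HA | | |].
  - apply ty_le with k; [lia | apply HA].
  - apply ty_le with k; [lia | apply HA].
  - apply teq_le with k; [lia | apply HA].
Qed.

Lemma famR_at G s D X X' A A' x x' t t' :
  famR G s D X X' A A' x x' -> tmR G s D t t' (cst Int) (cst Int) ->
  tyR G s D (at_fam A x t) (at_fam A' x' t').
Proof. intros H Ht; eapply tyR_of_tmR_U, famR_at_tm; [exact H | exact Ht]. Qed.

Lemma famR_id G X A x : fam G X A x -> famR G sid G X X A A x x.
Proof.
  intros [HG HX HA Hx].
  pose proof (tyR_id _ _ HG HX) as RX.
  pose proof (tyR_U _ _ _ k k_lt_N (wsub_id _ HG)) as RU.
  pose proof (tyR_Int _ _ _ (wsub_id _ HG)) as RI.
  constructor; [exact RX | |]; apply tmR_id; auto.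
  - eapply tyR_l, tyR_arr; [exact RX | exact RU].
  - eapply tyR_l, tyR_arr; [exact RI | exact RX].
Qed.

Lemma famR_sext G s D X X' A A' x x' B B' u :
  famR G s D X X' A A' x x' -> tyR G s D B B' -> has_type Sg G u B' ->
  famR G (sext [] s u) (cext D [] B) (up X) X' (up A) A' (up x) x'.
Proof.
  intros [HX HA Hx] HB Hu.
  pose proof (wsub_sext _ _ _ _ _ _ HB Hu) as Hs.
  pose proof (tyR_up_sext _ _ _ _ _ _ _ _ HB Hu HX) as RX.
  pose proof (tyR_U _ _ _ k k_lt_N Hs) as RU.
  pose proof (tyR_Int _ _ _ Hs) as RI.
  pose proof (wsub_wk _ _ _ (ws_cod _ _ _ Hs)) as Hwk.
  assert (WX : tyR (cext D [] B) wk D X (up X)) by (apply tyR_sb; [exact Hwk | apply HX]).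
  constructor; [exact RX | |]; eapply tmR_conv.
  - eapply tmR_up_sext; [exact HB | exact Hu | exact HA].
  - apply tyR_arr; [exact RX | exact RU].
  - eapply tyR_eq, tyR_arr; [exact WX | apply tyR_U; [exact k_lt_N | exact Hwk]].
  - eapply tmR_up_sext; [exact HB | exact Hu | exact Hx].
  - apply tyR_arr; [exact RI | exact RX].
  - eapply tyR_eq, tyR_arr; [apply tyR_Int, Hwk | exact WX].
Qed.

Lemma famR_wk G X A x B :
  fam G X A x -> ctx_ok Sg (cext G [] B) ->
  famR (cext G [] B) wk G X (up X) A (up A) x (up x).
Proof.
  intros [HG HX HA Hx] HB; pose proof (wsub_wk _ _ _ HB) as Hwk.
  pose proof (tyR_up _ _ _ HB HX) as WX.
  pose proof (tyR_U _ _ _ k k_lt_N Hwk) as WU.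
  pose proof (tyR_Int _ _ _ Hwk) as WI.
  pose proof (tyR_arr _ _ _ _ _ _ _ WX WU) as WXU.
  pose proof (tyR_arr _ _ _ _ _ _ _ WI WX) as WIX.
  constructor; [exact WX | |]; eapply tmR_convr.
  - apply tmR_up; [exact HB | apply WXU | exact HA].
  - exact WXU.
  - apply tmR_up; [exact HB | apply WIX | exact Hx].
  - exact WIX.
Qed.

Lemma famR_comp G D E s r X X' X'' A A' A'' x x' x'' :
  famR D s E X X' A A' x x' -> famR G r D X' X'' A' A'' x' x'' ->
  famR G (scomp s r) E X X'' A A'' x x''.
Proof. intros [] []; constructor; eauto using tyR_comp, tmR_comp. Qed.

Lemma famR_lift G s D X X' A A' x x' B B' :
  famR G s D X X' A A' x x' -> tyR G s D B B' ->
  famR (cext G [] B') (lift [] s) (cext D [] B) (up X) (up X') (up A) (up A') (up x) (up x').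
Proof.
  intros H HB; pose proof (tyR_okr _ _ _ _ _ HB) as HB'.
  eapply famR_sext; [eapply famR_comp; [exact H |] | |].
  - apply famR_wk; [eapply famR_r, H | exact HB'].
  - apply tyR_wkr; [exact HB | exact HB'].
  - apply ty_v0, HB'.
Qed.

Lemma fam_up G X A x B :
  fam G X A x -> ctx_ok Sg (cext G [] B) -> fam (cext G [] B) (up X) (up A) (up x).
Proof. intros H HB; eapply famR_r, famR_wk; [exact H | exact HB]. Qed.

Lemma fam_at_up G X A x B t :
  fam G X A x -> ctx_ok Sg (cext G [] B) ->
  tmR (cext G [] B) wk G t t (cst Int) (cst Int) ->
  tm_eq Sg (cext G [] B) (up (at_fam A x t)) (at_fam (up A) (up x) t) (U N).
Proof. intros H HB Ht; eapply tyR_eq, famR_at; [apply famR_wk; eauto | exact Ht]. Qed.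

Lemma ok_Int G : ctx_ok Sg G -> ctx_ok Sg (cext G [] (cst Int)).
Proof. intros HG; eapply ok_ext; [exact HG | apply ty_Int, HG]. Qed.

Lemma Int_v0 G s D : wsub G s D ->
  tmR (cext G [] (cst Int)) (lift [] s) (cext D [] (cst Int)) (v 0) (v 0) (cst Int) (cst Int).
Proof.
  intros Hs; pose proof (tyR_Int _ _ _ Hs) as HI.
  eapply tmR_conv; [apply tmR_v0, HI | apply tyR_Int, wsub_lift, HI |].
  eapply tyR_eq, tyR_Int, wsub_wk, ok_Int, Hs.
Qed.

Lemma famR_body G s D X X' A A' x x' :
  famR G s D X X' A A' x x' ->
  tyR (cext G [] (cst Int)) (lift [] s) (cext D [] (cst Int)) (fam_body A x) (fam_body A' x').
Proof.
  intros H; pose proof (tyR_sub _ _ _ _ _ (famR_base _ _ _ _ _ _ _ _ _ H)) as Hs.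
  eapply famR_at; [eapply famR_lift; [exact H | apply tyR_Int, Hs] | apply Int_v0, Hs].
Qed.

Lemma fam_body_inst G X A x t :
  fam G X A x -> has_type Sg G t (cst Int) ->
  tyR G (inst [] t) (cext G [] (cst Int)) (fam_body A x) (at_fam A x t).
Proof.
  intros H Ht; pose proof (fam_ok _ _ _ _ H) as HG.
  pose proof (tyR_Int _ _ _ (wsub_id _ HG)) as HI.
  eapply famR_at; [eapply famR_sext; [apply famR_id, H | exact HI | exact Ht] |].
  eapply tmR_conv; [eapply tmR_v0_sext; [exact HI | exact Ht] | |].
  - eapply tyR_Int, wsub_sext; [exact HI | exact Ht].
  - eapply tyR_eq, tyR_Int, wsub_wk, ok_Int, HG.
Qed.

(** The equation is imposed only at the generic point of I, since substitution then yields it at the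
    endpoints and at every bound interval variable. The bases are hidden by existentials, so they
    may differ. *)
Record famE G A A' x x' : Prop := FamE {
  famE_l : exists X, fam G X A x;
  famE_r : exists X, fam G X A' x';
  famE_eq : tm_eq Sg (cext G [] (cst Int)) (fam_body A x) (fam_body A' x') (U N) }.

Lemma famE_at G A A' x x' t :
  famE G A A' x x' -> has_type Sg G t (cst Int) ->
  tm_eq Sg G (at_fam A x t) (at_fam A' x' t) (U N).
Proof.
  intros [[X H] [X' H'] HE] Ht.
  pose proof (fam_body_inst _ _ _ _ _ H Ht) as RB.
  pose proof (fam_body_inst _ _ _ _ _ H' Ht) as RB'.
  eapply teq_trans; [apply teq_sym, RB |]. eapply teq_trans; [| apply RB'].
  eapply teq_sb_U; [apply seq_refl, RB | apply RB | exact HE].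
Qed.

Lemma famE_up G A A' x x' B :
  famE G A A' x x' -> ctx_ok Sg (cext G [] B) ->
  famE (cext G [] B) (up A) (up A') (up x) (up x').
Proof.
  intros [[X H] [X' H'] HE] HB.
  pose proof (famR_body _ _ _ _ _ _ _ _ _ (famR_wk _ _ _ _ _ H HB)) as RB.
  pose proof (famR_body _ _ _ _ _ _ _ _ _ (famR_wk _ _ _ _ _ H' HB)) as RB'.
  constructor; [eexists; eapply fam_up; eauto | eexists; eapply fam_up; eauto |].
  eapply teq_trans; [apply teq_sym, RB |]. eapply teq_trans; [| apply RB'].
  eapply teq_sb_U; [apply seq_refl, RB | apply RB | exact HE].
Qed.

(* Unlike [famR], the two families may have unrelated bases: only their
   restrictions to the interval are compared. *)
Definition arrR G s D A A' x x' : Prop :=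
  exists X X1 A1 x1, famR G s D X X1 A A1 x x1 /\ famE G A1 A' x1 x'.

Lemma arrR_at G s D A A' x x' t t' :
  arrR G s D A A' x x' -> tmR G s D t t' (cst Int) (cst Int) ->
  tyR G s D (at_fam A x t) (at_fam A' x' t').
Proof.
  intros (X & X1 & A1 & x1 & H & HE) Ht.
  eapply tyR_convr; [eapply famR_at; [exact H | exact Ht] | |].
  - destruct (famE_r _ _ _ _ _ HE) as [X' H'].
    eapply tyR_r, fam_body_inst; [exact H' | apply Ht].
  - apply famE_at; [exact HE | apply Ht].
Qed.

Lemma arrR_lift G s D A A' x x' B B' :
  arrR G s D A A' x x' -> tyR G s D B B' ->
  arrR (cext G [] B') (lift [] s) (cext D [] B) (up A) (up A') (up x) (up x').
Proof.
  intros (X & X1 & A1 & x1 & H & HE) HB.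
  exists (up X), (up X1), (up A1), (up x1); split.
  - eapply famR_lift; [exact H | exact HB].
  - apply famE_up; [exact HE | eapply tyR_okr, HB].
Qed.

Lemma arrR_fam G s D A A' x x' : arrR G s D A A' x x' -> exists X, fam D X A x.
Proof. intros (X & X1 & A1 & x1 & H & _); exists X; eapply famR_l, H. Qed.

Lemma arrR_sub G s D A A' x x' : arrR G s D A A' x x' -> wsub G s D.
Proof. intros (X & X1 & A1 & x1 & [H] & _); apply H. Qed.

Lemma arrR_body G s D A A' x x' :
  arrR G s D A A' x x' ->
  tyR (cext G [] (cst Int)) (lift [] s) (cext D [] (cst Int)) (fam_body A x) (fam_body A' x').
Proof.
  intros H; pose proof (arrR_sub _ _ _ _ _ _ _ H) as Hs.
  eapply arrR_at; [eapply arrR_lift; [exact H | apply tyR_Int, Hs] | apply Int_v0, Hs].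
Qed.

(** * Dependent arrows and covariance along one arrow *)

Lemma arrR_section G s D A A' x x' :
  arrR G s D A A' x x' -> tyR G s D (PiI (fam_body A x)) (PiI (fam_body A' x')).
Proof.
  intros H; apply tyR_Pi; [eapply tyR_Int, arrR_sub, H | apply arrR_body, H].
Qed.

(** The quantified hypothesis expresses that [t] is a closed point of I, stable under every
    substitution; it is meant for the two endpoints. The conversions replace an instantiated
    [fam_body] by the corresponding [at_fam]. *)
Lemma arrR_eval G s D A A' x x' t :
  arrR G s D A A' x x' -> (forall G s D, wsub G s D -> tmR G s D t t (cst Int) (cst Int)) ->
  tmR (cext G [] (PiI (fam_body A' x'))) (lift [] s) (cext D [] (PiI (fam_body A x)))
    (ap (v 0) t) (ap (v 0) t)
    (at_fam (up A) (up x) t) (at_fam (up A') (up x') t).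
Proof.
  intros H Ht; pose proof (arrR_section _ _ _ _ _ _ _ H) as HP.
  pose proof (wsub_lift _ _ _ _ _ HP) as HsP.
  pose proof (arrR_lift _ _ _ _ _ _ _ _ _ H HP) as HL.
  destruct (arrR_fam _ _ _ _ _ _ _ H) as [X HF].
  eapply tmR_conv.
  - eapply tmR_app; [apply arrR_body, HL | | apply Ht, HsP].
    eapply tmR_conv; [apply tmR_v0, HP | apply arrR_section, HL |].
    eapply tyR_eq, tyR_Pi; [apply tyR_Int, wsub_wk, HsP |].
    eapply famR_body, famR_wk; [exact HF | apply HsP].
  - eapply arrR_at; [exact HL | apply Ht, HsP].
  - eapply tyR_eq, fam_body_inst; [eapply fam_up; [exact HF | apply HsP] |].
    eapply tmR_l, Ht, HsP.
Qed.

Lemma arrR_pt_up G s D A A' x x' a a' B B' t :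
  arrR G s D A A' x x' -> tyR G s D B B' ->
  (forall G s D, wsub G s D -> tmR G s D t t (cst Int) (cst Int)) ->
  tmR G s D a a' (at_fam A x t) (at_fam A' x' t) ->
  tmR (cext G [] B') (lift [] s) (cext D [] B) (up a) (up a')
    (at_fam (up A) (up x) t) (at_fam (up A') (up x') t).
Proof.
  intros H HB Ht Ha; pose proof (wsub_lift _ _ _ _ _ HB) as HsB.
  destruct (arrR_fam _ _ _ _ _ _ _ H) as [X HF].
  eapply tmR_conv; [eapply tmR_lift; [exact HB | exact Ha] | |].
  - eapply arrR_at; [eapply arrR_lift; [exact H | exact HB] | apply Ht, HsB].
  - eapply fam_at_up; [exact HF | apply HsB | apply Ht, wsub_wk, HsB].
Qed.

Lemma arrR_darr G s D A A' x x' a0 a0' a1 a1' :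
  arrR G s D A A' x x' ->
  tmR G s D a0 a0' (at_fam A x i0) (at_fam A' x' i0) ->
  tmR G s D a1 a1' (at_fam A x i1) (at_fam A' x' i1) ->
  tyR G s D (darr A x a0 a1) (darr A' x' a0' a1').
Proof.
  intros H H0 H1; pose proof (arrR_section _ _ _ _ _ _ _ H) as HP.
  apply tyR_Sig; [exact HP |]. apply tyR_Sig; [| apply tyR_lift].
  1, 2: apply tyR_Id; [apply arrR_eval; [exact H | exact tmR_i0] |].
  1, 2: eapply arrR_pt_up; [exact H | exact HP | exact tmR_i0 | exact H0].
  apply tyR_Id; [apply arrR_eval; [exact H | exact tmR_i1] |].
  eapply arrR_pt_up; [exact H | exact HP | exact tmR_i1 | exact H1].
Qed.

(* [isCov X A] is convertible to [Pi [] (arr (cst Int) X) (isCovAt (up A) (v 0))]. *)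
Definition isCovAt A x : Tm Sg :=
  Pi [] (at_fam A x i0)
    (isContr (Sig (at_fam (up A) (up x) i1) (darr (up (up A)) (up (up x)) (v 1) (v 0)))).

(** In [isCovAt], including the section type inside [darr], [A] and [x] occur only jointly as some
    [at_fam], and [arrR] controls exactly these. *)
Lemma arrR_isCovAt G s D A A' x x' :
  arrR G s D A A' x x' -> tyR G s D (isCovAt A x) (isCovAt A' x').
Proof.
  intros H; pose proof (arrR_sub _ _ _ _ _ _ _ H) as Hs.
  pose proof (arrR_at _ _ _ _ _ _ _ _ _ H (tmR_i0 _ _ _ Hs)) as P0.
  pose proof (arrR_lift _ _ _ _ _ _ _ _ _ H P0) as HL.
  pose proof (wsub_lift _ _ _ _ _ P0) as Hs0.
  pose proof (arrR_at _ _ _ _ _ _ _ _ _ HL (tmR_i1 _ _ _ Hs0)) as P1.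
  pose proof (arrR_lift _ _ _ _ _ _ _ _ _ HL P1) as HLL.
  pose proof (wsub_lift _ _ _ _ _ P1) as Hs1.
  destruct (arrR_fam _ _ _ _ _ _ _ H) as [X HF].
  destruct (arrR_fam _ _ _ _ _ _ _ HL) as [X' HF'].
  apply tyR_Pi; [exact P0 |]. apply tyR_isContr, tyR_Sig; [exact P1 |].
  apply arrR_darr; [exact HLL | |].
  - eapply arrR_pt_up; [exact HL | exact P1 | exact tmR_i0 |].
    eapply tmR_conv; [apply tmR_v0, P0 | |].
    + eapply arrR_at; [exact HL | apply tmR_i0, Hs0].
    + eapply fam_at_up; [exact HF | apply Hs0 | apply tmR_i0, wsub_wk, Hs0].
  - eapply tmR_conv; [apply tmR_v0, P1 | |].
    + eapply arrR_at; [exact HLL | apply tmR_i1, Hs1].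
    + eapply fam_at_up; [exact HF' | apply Hs1 | apply tmR_i1, wsub_wk, Hs1].
Qed.

Lemma famE_refl G X A x : fam G X A x -> famE G A A x x.
Proof.
  intros H; constructor; [eauto | eauto |].
  apply teq_refl; eapply tyR_l, famR_body, famR_id, H.
Qed.

(** [v 0] is the generic arrow of the source base, and extending by [x] specialises it. This serves
    both to go under the binder of [isCov] and to evaluate a covariance proof at a concrete
    arrow. *)
Lemma famR_generic_sext G s D X X' A A' x :
  tyR G s D X X' -> tmR G s D A A' (arr X (U k)) (arr X' (U k)) ->
  has_type Sg G x (arr (cst Int) X') ->
  famR G (sext [] s x) (cext D [] (arr (cst Int) X)) (up X) X' (up A) A' (v 0) x.
Proof.
  intros HX HA Hx; pose proof (tyR_sub _ _ _ _ _ HX) as Hs.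
  pose proof (tyR_arr _ _ _ _ _ _ _ (tyR_Int _ _ _ Hs) HX) as HP.
  pose proof (wsub_sext _ _ _ _ _ _ HP Hx) as Hsx.
  pose proof (tyR_up_sext _ _ _ _ _ _ _ _ HP Hx HX) as HX1.
  pose proof (wsub_wk _ _ _ (ws_cod _ _ _ Hsx)) as Hwk.
  assert (WX : tyR (cext D [] (arr (cst Int) X)) wk D X (up X))
    by (apply tyR_sb; [exact Hwk | apply HX]).
  constructor; [exact HX1 | |]; eapply tmR_conv.
  - eapply tmR_up_sext; [exact HP | exact Hx | exact HA].
  - apply tyR_arr; [exact HX1 | apply tyR_U; [exact k_lt_N | exact Hsx]].
  - eapply tyR_eq, tyR_arr; [exact WX | apply tyR_U; [exact k_lt_N | exact Hwk]].
  - eapply tmR_v0_sext; [exact HP | exact Hx].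
  - apply tyR_arr; [apply tyR_Int, Hsx | exact HX1].
  - eapply tyR_eq, tyR_arr; [apply tyR_Int, Hwk | exact WX].
Qed.

Lemma famR_generic G s D X X' A A' :
  tyR G s D X X' -> tmR G s D A A' (arr X (U k)) (arr X' (U k)) ->
  famR (cext G [] (arr (cst Int) X')) (lift [] s) (cext D [] (arr (cst Int) X))
    (up X) (up X') (up A) (up A') (v 0) (v 0).
Proof.
  intros HX HA; pose proof (tyR_sub _ _ _ _ _ HX) as Hs.
  pose proof (tyR_arr _ _ _ _ _ _ _ (tyR_Int _ _ _ Hs) HX) as HP.
  pose proof (tyR_okr _ _ _ _ _ HP) as HP'.
  pose proof (wsub_wk _ _ _ HP') as Hwk.
  pose proof (tyR_wkr _ _ _ _ _ _ HX HP') as HX1.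
  apply famR_generic_sext; [exact HX1 | |].
  - eapply tmR_convr; [apply tmR_wkr; [exact HA | exact HP'] |].
    apply tyR_arr; [exact HX1 | apply tyR_U; [exact k_lt_N | apply HX1]].
  - eapply ty_conv; [apply ty_v0, HP' |].
    eapply tyR_eq, tyR_arr; [apply tyR_Int, Hwk | apply tyR_up; [exact HP' | apply HX]].
Qed.

Lemma tyR_isCov G s D X X' A A' :
  tyR G s D X X' -> tmR G s D A A' (arr X (U k)) (arr X' (U k)) ->
  tyR G s D (isCov X A) (isCov X' A').
Proof.
  intros HX HA; pose proof (tyR_sub _ _ _ _ _ HX) as Hs.
  pose proof (famR_generic _ _ _ _ _ _ _ HX HA) as HF.
  change (tyR G s D (Pi [] (arr (cst Int) X) (isCovAt (up A) (v 0)))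
    (Pi [] (arr (cst Int) X') (isCovAt (up A') (v 0)))).
  apply tyR_Pi; [apply tyR_arr; [apply tyR_Int, Hs | exact HX] |].
  apply arrR_isCovAt; do 4 eexists; split; [exact HF |].
  eapply famE_refl, famR_r, HF.
Qed.

(** * Locks, unit and counit, and transposition *)

Lemma wsub_lock G s D g : wsub G s D -> wsub (clock G g) (slock g s) (clock D g).
Proof. intros []; constructor; [apply ok_lock | apply ok_lock | apply sub_lock]; assumption. Qed.

Lemma wsub_eta G : ctx_ok Sg G -> wsub (clock (clock G ga) gp) seta G.
Proof. intros; constructor; [repeat apply ok_lock | | apply sub_eta]; assumption. Qed.

Lemma wsub_eps G : ctx_ok Sg G -> wsub G seps (clock (clock G gp) ga).
Proof. intros; constructor; [| repeat apply ok_lock | apply sub_eps]; assumption. Qed.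

Lemma wsub_p2I G : ctx_ok Sg G -> wsub (clock G gp) sp2I (cext G [] (cst Int)).
Proof. intros; constructor; [apply ok_lock | apply ok_Int | apply sub_p2I]; assumption. Qed.

Lemma wsub_I2p G : ctx_ok Sg G -> wsub (cext G [] (cst Int)) sI2p (clock G gp).
Proof. intros; constructor; [apply ok_Int | apply ok_lock | apply sub_I2p]; assumption. Qed.

(** Naturality of an inverse: the naturality square of [sp2I] is conjugated by the two inverse
    laws. *)
Lemma seq_I2p_nat G D s :
  wsub G s D ->
  sub_eq Sg (cext G [] (cst Int)) (scomp sI2p (lift [] s)) (scomp (slock gp s) sI2p)
    (clock D gp).
Proof.
  intros Hs; pose proof Hs as [HG HD Hss].
  pose proof (wsub_lift _ _ _ _ _ (tyR_Int _ _ _ Hs)) as HL.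
  pose proof (wsub_I2p _ HG) as IG; pose proof (wsub_I2p _ HD) as ID.
  pose proof (wsub_p2I _ HG) as PG; pose proof (wsub_p2I _ HD) as PD.
  pose proof (wsub_lock _ _ _ gp Hs) as Hls.
  pose proof (wsub_comp _ _ _ _ _ PG IG) as PIG.
  eapply seq_trans.
  { apply seq_sym, seq_idr. eapply sub_comp; [apply HL | apply ID]. }
  eapply seq_trans.
  { eapply seq_comp; [apply seq_sym, seq_p2I_I2p, HG | apply seq_refl].
    eapply sub_comp; [apply HL | apply ID]. }
  eapply seq_trans.
  { apply seq_sym. eapply seq_assoc; [apply IG | apply PG |].
    eapply sub_comp; [apply HL | apply ID]. }
  eapply seq_comp; [apply seq_refl, IG |].
  eapply seq_trans.
  { eapply seq_assoc; [apply PG | apply HL | apply ID]. }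
  eapply seq_trans.
  { eapply seq_comp; [apply seq_sym, seq_p2I_nat, Hss | apply seq_refl, ID]. }
  eapply seq_trans.
  { apply seq_sym. eapply seq_assoc; [apply Hls | apply PD | apply ID]. }
  eapply seq_trans.
  { eapply seq_comp; [apply seq_refl, Hls | apply seq_I2p_p2I, HD]. }
  apply seq_idl, Hls.
Qed.

(* Dependent transposition along the adjunction: the [letmod] framed by [gp]
   opens [t] under the lock, and the counit removes both locks. *)
Lemma transpose G B t :
  ctx_ok Sg G -> has_type Sg (clock (clock G gp) ga) B (U N) ->
  has_type Sg (clock G gp) t (Mod [ga] B) ->
  exists w : Tm Sg, has_type Sg G w (sb B seps).
Proof.
  intros HG HB Ht.
  pose proof (wsub_eps _ HG) as Heps.
  assert (HM : has_type Sg (clock G gp) (Mod [ga] B) (U N)).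
  { apply ty_Mod; [apply ok_lock, HG | exact HB]. }
  assert (OM : ctx_ok Sg (cext G [gp] (Mod [ga] B))) by (eapply ok_ext; eauto).
  assert (OB : ctx_ok Sg (cext G [gp; ga] B)) by (eapply ok_ext; eauto).
  pose proof (wsub_wk _ _ _ OM) as WM; pose proof (wsub_wk _ _ _ OB) as WB.
  pose proof (wsub_lock _ _ _ ga (wsub_lock _ _ _ gp WB)) as WBl.
  pose proof (wsub_eps _ OB) as HepsB.
  assert (HBe : has_type Sg G (sb B seps) (U N)) by (eapply ty_sb_U; [apply Heps | exact HB]).
  pose proof (ty_var Sg G [gp; ga] B OB) as Hv; simpl in Hv.
  assert (Hmkv : has_type Sg (clock (cext G [gp; ga] B) gp) (mkmod [ga] (var [gp; ga]))
    (sb (Mod [ga] B) (slock gp wk))).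
  { eapply ty_conv.
    - eapply ty_mod with (i := N); [apply ok_lock, OB | | exact Hv].
      eapply ty_sb_U; [apply WBl | exact HB].
    - apply teq_sym.
      eapply (teq_Mod_sb Sg _ _ (slock gp wk) [ga]); [apply sub_lock, WB | exact HB]. }
  assert (Hmk : sub Sg (cext G [gp; ga] B) (sext [gp] wk (mkmod [ga] (var [gp; ga])))
    (cext G [gp] (Mod [ga] B))).
  { eapply sub_ext; [apply WB | exact HM | exact Hmkv]. }
  assert (Ht' : has_type Sg (clock G gp) t (sb (Mod [ga] B) (slock gp sid))).
  { eapply ty_conv; [exact Ht |].
    eapply teq_trans; [apply teq_sym, teq_sb_id, HM |].
    eapply teq_sb_U; [apply seq_sym, seq_lock_id, HG | apply sub_id, ok_lock, HG |].
    apply teq_refl, HM. }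
  assert (Hin : sub Sg G (inst [gp] t) (cext G [gp] (Mod [ga] B))).
  { eapply sub_ext; [apply sub_id, HG | exact HM | exact Ht']. }
  exists (letmod [gp] [ga] (up (sb B seps)) t (sb (var [gp; ga]) seps)).
  eapply ty_conv with (i := N).
  { eapply ty_letmod with (i := N) (j := N); [exact HB | | exact Ht |].
    - eapply ty_sb_U; [apply WM | exact HBe].
    - eapply ty_conv with (i := N).
      + eapply ty_sb; [apply HepsB | exact Hv].
      + eapply teq_trans; [eapply teq_sb_comp_U; [apply HepsB | apply WBl | exact HB] |].
        (* Naturality of the counit moves the weakening past [seps], which turns the type of the
           released variable into the weakened, constant motive. *)
        eapply teq_trans.
        { eapply teq_sb_U; [apply seq_sym, seq_eps_nat, WB | | apply teq_refl, HB].
          eapply sub_comp; [apply HepsB | apply WBl]. }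
        eapply teq_trans.
        { apply teq_sym. eapply teq_sb_comp_U; [apply WB | apply Heps | exact HB]. }
        apply teq_sym. eapply teq_trans.
        { eapply teq_sb_comp_U; [exact Hmk | apply WM | exact HBe]. }
        eapply teq_sb_U; [| eapply sub_comp; [exact Hmk | apply WM] | apply teq_refl, HBe].
        eapply seq_wk_ext with (i := N); [apply WB | exact HM | exact Hmkv]. }
  eapply teq_trans.
  { eapply teq_sb_comp_U; [exact Hin | apply WM | exact HBe]. }
  eapply teq_trans; [| apply teq_sb_id, HBe].
  eapply teq_sb_U; [| eapply sub_comp; [exact Hin | apply WM] | apply teq_refl, HBe].
  eapply seq_wk_ext with (i := N); [apply sub_id, HG | exact HM | exact Ht'].
Qed.

(** The family inside [isAmazinglyCov (v 0)], for the generic code of a context extended by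
    [U k]. *)
Definition code_fam : Tm Sg := lam [] (sb (sb (v 0) seta) sI2p).

Lemma wsub_eta_I2p G :
  ctx_ok Sg G -> wsub (cext (clock G ga) [] (cst Int)) (scomp seta sI2p) G.
Proof.
  intros HG; eapply wsub_comp; [apply wsub_eta, HG | apply wsub_I2p, ok_lock, HG].
Qed.

(* The substitution [slock ga (s o sp2I) o seps] is the transpose of [s]; its
   defining property is one of the triangle identities. *)
Lemma transpose_beta G D s :
  wsub (cext G [] (cst Int)) s D -> ctx_ok Sg G ->
  let r := scomp (slock ga (scomp s sp2I)) seps in
  sub_eq Sg (cext G [] (cst Int)) (scomp (scomp seta sI2p) (lift [] r)) s D.
Proof.
  intros Hs HG r.
  pose proof (ws_cod _ _ _ Hs) as HD.
  pose proof (wsub_p2I _ HG) as PG; pose proof (wsub_I2p _ HG) as IG.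
  pose proof (wsub_eps _ HG) as EG; pose proof (wsub_lock _ _ _ gp EG) as LEG.
  pose proof (wsub_comp _ _ _ _ _ Hs PG) as Hq.
  pose proof (wsub_lock _ _ _ ga Hq) as Hqa.
  pose proof (wsub_lock _ _ _ gp Hqa) as Hqap.
  assert (Hr : wsub G r (clock D ga)) by (eapply wsub_comp; [exact Hqa | exact EG]).
  pose proof (wsub_lock _ _ _ gp Hr) as Hrp.
  pose proof (wsub_lift _ _ _ _ _ (tyR_Int _ _ _ Hr)) as HL.
  pose proof (wsub_eta _ HD) as ED.
  pose proof (wsub_I2p _ (ok_lock _ _ ga HD)) as ID.
  pose proof (wsub_eta _ (ok_lock _ _ gp HG)) as EtG.
  eapply seq_trans; [eapply seq_assoc; [apply HL | apply ID | apply ED] |].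
  eapply seq_trans.
  { eapply seq_comp; [apply seq_I2p_nat, Hr | apply seq_refl, ED]. }
  eapply seq_trans.
  { apply seq_sym; eapply seq_assoc; [apply IG | apply Hrp | apply ED]. }
  (* The transposition equation proper, stated under the lock [gp]. The remaining [sp2I] and [sI2p]
     are mutually inverse and cancel afterwards. *)
  assert (Hkey : sub_eq Sg (clock G gp) (scomp seta (slock gp r)) (scomp s sp2I) D).
  { eapply seq_trans.
    { eapply seq_comp; [| apply seq_refl, ED].
      eapply seq_lock_comp; [apply EG | apply Hqa]. }
    eapply seq_trans.
    { apply seq_sym; eapply seq_assoc; [apply LEG | apply Hqap | apply ED]. }
    eapply seq_trans.
    { eapply seq_comp; [apply seq_refl, LEG | apply seq_eta_nat, Hq]. }
    eapply seq_trans.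
    { eapply seq_assoc; [apply LEG | apply EtG | apply Hq]. }
    eapply seq_trans.
    { eapply seq_comp; [apply seq_triangle_p, HG | apply seq_refl, Hq]. }
    apply seq_idr, Hq. }
  eapply seq_trans; [eapply seq_comp; [apply seq_refl, IG | exact Hkey] |].
  eapply seq_trans; [eapply seq_assoc; [apply IG | apply PG | apply Hs] |].
  eapply seq_trans; [eapply seq_comp; [apply seq_p2I_I2p, HG | apply seq_refl, Hs] |].
  apply seq_idr, Hs.
Qed.

Lemma ok_U G : ctx_ok Sg G -> ctx_ok Sg (cext G [] (U k)).
Proof. intros HG; eapply ok_ext; [exact HG | apply ty_U, HG]. Qed.

Lemma ty_v0_U G : ctx_ok Sg G -> has_type Sg (cext G [] (U k)) (v 0) (U k).
Proof.
  intros HG; eapply ty_conv; [apply ty_v0, ok_U, HG |].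
  eapply teq_U_sb, sub_wk, ok_U, HG.
Qed.

(** Along the transpose of [s], the unit in [code_fam] is absorbed by [transpose_beta]; what is left
    is the code selected by [s], with the interval variable abstracted. *)
Lemma tmR_code_fam G D s :
  ctx_ok Sg G -> ctx_ok Sg D -> wsub (cext G [] (cst Int)) s (cext D [] (U k)) ->
  tmR G (scomp (slock ga (scomp s sp2I)) seps) (clock (cext D [] (U k)) ga)
    code_fam (lam [] (sb (v 0) s)) (arr (cst Int) (U k)) (arr (cst Int) (U k)).
Proof.
  intros HG HD Hs; set (r := scomp _ seps).
  pose proof (ok_U _ HD) as HU.
  assert (Hr : wsub G r (clock (cext D [] (U k)) ga)).
  { eapply wsub_comp; [| apply wsub_eps, HG].
    apply wsub_lock; eapply wsub_comp; [exact Hs | apply wsub_p2I, HG]. }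
  pose proof (tyR_Int _ _ _ Hr) as RI.
  pose proof (wsub_lift _ _ _ _ _ RI) as HL.
  pose proof (ty_v0_U _ HD) as Hv.
  pose proof (wsub_eta _ HU) as EU.
  pose proof (wsub_I2p _ (ok_lock _ _ ga HU)) as IU.
  pose proof (wsub_eta_I2p _ HU) as EIU.
  assert (Hbody : tmR (cext G [] (cst Int)) (lift [] r)
    (cext (clock (cext D [] (U k)) ga) [] (cst Int))
    (sb (sb (v 0) seta) sI2p) (sb (v 0) s) (U k) (U k)).
  { assert (He : has_type Sg (clock (clock (cext D [] (U k)) ga) gp) (sb (v 0) seta) (U k))
      by (eapply ty_sb_U; [apply EU | exact Hv]).
    constructor; [apply tyR_U; [exact k_lt_N | exact HL] | | |].
    - eapply ty_sb_U; [apply IU | exact He].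
    - eapply ty_sb_U; [apply Hs | exact Hv].
    - eapply teq_trans.
      { eapply teq_sb_U; [apply seq_refl, HL | apply HL |].
        eapply teq_sb_comp_U; [apply IU | apply EU | exact Hv]. }
      eapply teq_trans; [eapply teq_sb_comp_U; [apply HL | apply EIU | exact Hv] |].
      eapply teq_sb_U; [| eapply sub_comp; [apply HL | apply EIU] | apply teq_refl, Hv].
      apply (transpose_beta _ _ _ Hs HG). }
  eapply tmR_conv.
  - eapply tmR_lam; [exact RI | exact Hbody].
  - apply tyR_arr; [exact RI | apply tyR_U; [exact k_lt_N | exact Hr]].
  - apply teq_Pi; [apply teq_refl, RI |].
    apply teq_sym. eapply tyR_eq, tyR_U; [exact k_lt_N | apply wsub_wk, HL].
Qed.

(** The typing is the left half of a relation already established, so a single substitution into the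
    generic context is enough to extract it; [scomp seta sI2p] is one at hand. *)
Lemma ty_code_fam G :
  ctx_ok Sg G -> has_type Sg (clock (cext G [] (U k)) ga) (isCov (cst Int) code_fam) (U N).
Proof.
  intros HG; pose proof (ok_U _ HG) as HU; pose proof (ok_lock _ _ ga HU) as HUa.
  pose proof (wsub_eta_I2p _ HU) as Hs.
  pose proof (tmR_code_fam _ _ _ HUa HG Hs) as H.
  eapply tyR_l, tyR_isCov; [apply tyR_Int, H | exact H].
Qed.

Lemma ty_isAmazinglyCov_v0 G :
  ctx_ok Sg G -> has_type Sg (cext G [] (U k)) (isAmazinglyCov (v 0)) (U N).
Proof.
  intros HG; apply ty_Mod; [apply ok_U, HG | apply ty_code_fam, HG].
Qed.

(** Here [s] presents a type varying over I as an instance of the generic code. In this form the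
    modal type can be substituted by acting with the locked [s] on its body, which is what
    [transpose] consumes. *)
Lemma amazing_cov G D s t :
  ctx_ok Sg G -> ctx_ok Sg D -> wsub (cext G [] (cst Int)) s (cext D [] (U k)) ->
  has_type Sg (cext G [] (cst Int)) t (sb (isAmazinglyCov (v 0)) s) ->
  exists w : Tm Sg, has_type Sg G w (isCov (cst Int) (lam [] (sb (v 0) s))).
Proof.
  intros HG HD Hs Ht.
  pose proof (wsub_p2I _ HG) as PG; pose proof (wsub_comp _ _ _ _ _ Hs PG) as Hq.
  pose proof (ty_code_fam _ HD) as HB.
  pose proof (wsub_lock _ _ _ ga Hq) as Hqa.
  pose proof (tmR_code_fam _ _ _ HG HD Hs) as HR.
  destruct (transpose G (sb (isCov (cst Int) code_fam) (slock ga (scomp s sp2I))) (sb t sp2I))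
    as [w Hw]; [exact HG | eapply ty_sb_U; [apply Hqa | exact HB] | |].
  - eapply ty_conv; [eapply ty_sb; [apply PG | exact Ht] |].
    eapply teq_trans.
    { eapply teq_sb_comp_U; [apply PG | apply Hs | apply ty_isAmazinglyCov_v0, HD]. }
    eapply (teq_Mod_sb Sg _ _ _ [ga]); [apply Hq | exact HB].
  - exists w; eapply ty_conv; [exact Hw |].
    eapply teq_trans.
    { eapply teq_sb_comp_U; [apply wsub_eps, HG | apply Hqa | exact HB]. }
    eapply tyR_eq, tyR_isCov; [apply tyR_Int, HR | exact HR].
Qed.

(** * Beta rules for abstractions and first projections *)

Lemma lam_generic G A B t :
  ctx_ok Sg G -> has_type Sg G A (U N) -> has_type Sg (cext G [] A) B (U N) ->
  has_type Sg (cext G [] A) t B ->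
  tm_eq Sg (cext G [] A) (ap (up (lam [] t)) (v 0)) t B.
Proof.
  intros HG HA HB Ht; pose proof (ok_extN _ _ HG HA) as HGA.
  pose proof (tyR_up _ _ _ HGA HA) as WA; pose proof (wsub_lift _ _ _ _ _ WA) as HL.
  pose proof (tmR_sb _ _ _ _ _ HL HB Ht) as RL.
  pose proof (ty_v0 _ _ HGA) as Hv.
  assert (HI : wsub (cext G [] A) (inst [] (v 0)) (cext (cext G [] A) [] (up A))).
  { eapply wsub_sext; [apply tyR_id; [exact HGA | apply WA] | exact Hv]. }
  assert (RI : tmR (cext G [] A) (inst [] (v 0)) (cext (cext G [] A) [] (up A))
    (sb t (lift [] wk)) (sb (sb t (lift [] wk)) (inst [] (v 0)))
    (sb B (lift [] wk)) (sb (sb B (lift [] wk)) (inst [] (v 0)))).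
  { apply tmR_sb; [exact HI | apply RL | apply RL]. }
  (* Beta reduction leaves [t] under [lift [] wk] followed by [inst [] (v 0)]; by [lift_inst] and
     the eta rule for extensions this composite is the identity. *)
  assert (RC : tmR (cext G [] A) sid (cext G [] A)
    t (sb (sb t (lift [] wk)) (inst [] (v 0)))
    B (sb (sb B (lift [] wk)) (inst [] (v 0)))).
  { eapply tmR_seq; [eapply tmR_comp; [exact RL | exact RI] | apply wsub_id, HGA |].
    eapply seq_trans; [| eapply lift_inst; [exact WA | exact Hv]].
    eapply seq_trans; [eapply seq_ext_eta; [exact HGA | apply sub_id, HGA] |].
    apply seq_sym. eapply seq_ext with (i := N); [| exact HA |]; simpl.
    - apply seq_sym, seq_idr, WA.
    - apply teq_sym, teq_sb_id, Hv. }
  pose proof (tmR_id _ _ _ HGA HB Ht) as RD.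
  eapply teq_conv.
  2: { apply teq_sym. eapply tyR_fun; [apply RD | apply RC]. }
  eapply teq_trans.
  - eapply teq_app; [apply WA | apply RL | | apply teq_refl, Hv].
    eapply tmR_eq, tmR_lam; [exact WA | exact RL].
  - eapply teq_trans; [eapply teq_Pi_beta; [apply WA | apply RL | apply RL | exact Hv] |].
    eapply tmR_fun; [exact RC | exact RD].
Qed.

Definition fst_fun F : Tm Sg := lam [] (pr1 (ap (up F) (v 0))).

(** [T] is merely convertible to a Sigma type because it will be a weakened one, that is, a
    suspended substitution. *)
Lemma tmR_fst_ap G s D X X' T T' C F F' x x' :
  tyR G s D X X' -> tyR G s D T T' -> has_type Sg (cext D [] (U k)) C (U N) ->
  tm_eq Sg D T (Sig (U k) C) (U N) ->
  tmR G s D F F' (arr X T) (arr X' T') -> tmR G s D x x' X X' ->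
  tmR G s D (pr1 (ap F x)) (pr1 (ap F' x')) (U k) (U k).
Proof.
  intros HX HT HC HE HF Hx; pose proof (tyR_sub _ _ _ _ _ HX) as Hs.
  pose proof (tyR_U _ _ _ k k_lt_N Hs) as RU.
  pose proof (tyR_sb _ _ _ _ (wsub_lift _ _ _ _ _ RU) HC) as RC.
  eapply tmR_pr1; [exact RU | exact RC |].
  eapply tmR_conv; [eapply tmR_apN; [exact HT | exact HF | exact Hx] | | exact HE].
  apply tyR_Sig; [exact RU | exact RC].
Qed.

Lemma teq_arr_wk G X T B :
  ctx_ok Sg (cext G [] B) -> has_type Sg G X (U N) -> has_type Sg G T (U N) ->
  tm_eq Sg (cext G [] B) (up (arr X T)) (arr (up X) (up T)) (U N).
Proof. intros HB HX HT; eapply tyR_eq, tyR_arr; apply tyR_up; assumption. Qed.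

(** [C] stays abstract because these results are applied both to [isAmazinglyCov (v 0)] and to its
    image under a lifted substitution. *)
Section FirstProjection.
Context {G : Ctx Sg} {X C F : Tm Sg}.
Hypotheses (HG : ctx_ok Sg G) (HX : has_type Sg G X (U N))
  (HC : has_type Sg (cext G [] (U k)) C (U N))
  (HF : has_type Sg G F (arr X (Sig (U k) C))).

Lemma ty_SigU : has_type Sg G (Sig (U k) C) (U N).
Proof.
  apply ty_Sig; [| exact HC]. eapply tyR_l, tyR_U, wsub_id, HG. exact k_lt_N.
Qed.

Lemma up_SigU B :
  ctx_ok Sg (cext G [] B) ->
  has_type Sg (cext (cext G [] B) [] (U k)) (sb C (lift [] wk)) (U N) /\
  tm_eq Sg (cext G [] B) (up (Sig (U k) C)) (Sig (U k) (sb C (lift [] wk))) (U N).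
Proof.
  intros HB; pose proof (tyR_U _ _ _ k k_lt_N (wsub_wk _ _ _ HB)) as WU.
  pose proof (tyR_sb _ _ _ _ (wsub_lift _ _ _ _ _ WU) HC) as WC.
  split; [apply WC |]. eapply tyR_eq, tyR_Sig; [exact WU | exact WC].
Qed.

Lemma tmR_fst_fun D s X' C' F' :
  tyR D s G X X' -> tyR D s G (Sig (U k) C) (Sig (U k) C') ->
  tmR D s G F F' (arr X (Sig (U k) C)) (arr X' (Sig (U k) C')) ->
  tmR D s G (fst_fun F) (fst_fun F') (arr X (U k)) (arr X' (U k)).
Proof.
  intros RX RS RF.
  pose proof (tyR_okl _ _ _ _ _ RX) as OX.
  destruct (up_SigU X OX) as [HC1 HE].
  pose proof (wsub_lift _ _ _ _ _ RX) as HL.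
  pose proof (tyR_lift _ _ _ _ _ _ _ RX RX) as RX1.
  pose proof (tyR_lift _ _ _ _ _ _ _ RX RS) as RS1.
  eapply tmR_conv.
  - eapply tmR_lam; [exact RX |].
    eapply tmR_fst_ap; [exact RX1 | exact RS1 | exact HC1 | exact HE | | apply tmR_v0, RX].
    eapply tmR_conv; [eapply tmR_lift; [exact RX | exact RF] | |].
    + apply tyR_arr; [exact RX1 | exact RS1].
    + apply teq_arr_wk; [exact OX | exact HX | exact ty_SigU].
  - apply tyR_arr; [exact RX | apply tyR_U; [exact k_lt_N | apply RX]].
  - apply teq_Pi; [apply teq_refl, HX | apply teq_sym].
    eapply tyR_eq, tyR_U; [exact k_lt_N | apply wsub_wk, OX].
Qed.

Lemma ty_fst_fun : has_type Sg G (fst_fun F) (arr X (U k)).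
Proof.
  eapply tmR_l, tmR_fst_fun; [apply tyR_id; assumption | |].
  - apply tyR_id; [exact HG | exact ty_SigU].
  - apply tmR_id; [exact HG | | exact HF].
    eapply tyR_l, tyR_arr; apply tyR_id; try assumption. exact ty_SigU.
Qed.

Lemma fst_fun_beta x :
  has_type Sg G x X -> tm_eq Sg G (ap (fst_fun F) x) (pr1 (ap F x)) (U k).
Proof.
  intros Hx; pose proof (ok_extN _ _ HG HX) as OX.
  destruct (up_SigU X OX) as [HC1 HE].
  pose proof (tyR_id _ _ HG HX) as RX.
  pose proof (tyR_id _ _ HG ty_SigU) as RS.
  pose proof (wsub_sext _ _ _ _ _ _ RX Hx) as HI.
  assert (RF : tmR G sid G F F (arr X (Sig (U k) C)) (arr X (Sig (U k) C))).
  { apply tmR_id; [exact HG | | exact HF].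
    eapply tyR_l, tyR_arr; [exact RX | exact RS]. }
  assert (RB : tmR G (inst [] x) (cext G [] X) (pr1 (ap (up F) (v 0))) (pr1 (ap F x))
    (U k) (U k)).
  { pose proof (tyR_up_sext _ _ _ _ _ _ _ _ RX Hx RX) as RX1.
    pose proof (tyR_up_sext _ _ _ _ _ _ _ _ RX Hx RS) as RS1.
    eapply tmR_fst_ap; [exact RX1 | exact RS1 | exact HC1 | exact HE | |].
    - eapply tmR_conv; [eapply tmR_up_sext; [exact RX | exact Hx | exact RF] | |].
      + apply tyR_arr; [exact RX1 | exact RS1].
      + apply teq_arr_wk; [exact OX | exact HX | exact ty_SigU].
    - eapply tmR_v0_sext; [exact RX | exact Hx]. }
  eapply teq_trans; [| apply RB].
  eapply teq_conv; [| eapply teq_U_sb, HI].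
  eapply teq_Pi_beta; [exact HX | apply RB | apply RB | exact Hx].
Qed.

End FirstProjection.

(** * Covariance of the first projection *)

Lemma ty_apN G A B t u :
  ctx_ok Sg G -> has_type Sg G A (U N) -> has_type Sg G B (U N) ->
  has_type Sg G t (arr A B) -> has_type Sg G u A -> has_type Sg G (ap t u) B.
Proof.
  intros HG HA HB Ht Hu; eapply tmR_r, tmR_apN.
  - apply tyR_id; [exact HG | exact HB].
  - apply tmR_id; [exact HG | | exact Ht].
    eapply tyR_l, tyR_arr; apply tyR_id; assumption.
  - apply tmR_id; assumption.
Qed.

Lemma teq_apN G A B t t' u u' :
  ctx_ok Sg G -> has_type Sg G A (U N) -> has_type Sg G B (U N) ->
  tm_eq Sg G t t' (arr A B) -> has_type Sg G u A -> tm_eq Sg G u u' A ->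
  tm_eq Sg G (ap t u) (ap t' u') B.
Proof.
  intros HG HA HB Ht Hu Huu.
  eapply teq_conv; [| eapply teq_up_inst; [exact HG | exact HA | exact HB | exact Hu]].
  eapply teq_app; [exact HA | | exact Ht | exact Huu].
  eapply ty_sb_U; [apply sub_wk, ok_extN; [exact HG | exact HA] | exact HB].
Qed.

Lemma ty_idI G : ctx_ok Sg G -> has_type Sg G (lam [] (v 0)) (arr (cst Int) (cst Int)).
Proof.
  intros HG; pose proof (ok_Int _ HG) as HI.
  eapply ty_lam with (i := 0); [apply ty_Int, HG | | apply ty_v0, HI].
  eapply ty_sb_U; [apply sub_wk, HI | apply ty_Int, HG].
Qed.

Lemma cov_of_amazing_cov G X F :
  ctx_ok Sg G -> has_type Sg G X (U N) ->
  has_type Sg G F (arr X (Sig (U k) (isAmazinglyCov (v 0)))) ->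
  exists t : Tm Sg, has_type Sg G t (isCov X (fst_fun F)).
Proof.
  intros HG HX HF.
  pose proof (ty_isAmazinglyCov_v0 _ HG) as HC.
  set (C := isAmazinglyCov (v 0)) in *.
  pose proof (ty_SigU HG HC) as HS.
  pose proof (ty_fst_fun HG HX HC HF) as HA.
  set (A := fst_fun F) in *.
  pose proof (tyR_id _ _ HG HX) as RX0.
  pose proof (tyR_arr _ _ _ _ _ _ _ (tyR_Int _ _ _ (wsub_id _ HG)) RX0) as RP0.
  (* [G1] adds the generic arrow x of [X], and [GI] below adds a generic point i of I. Then [y] is x
     i and [Q] is F (x i). *)
  set (G1 := cext G [] (arr (cst Int) X)).
  assert (O1 : ctx_ok Sg G1) by (eapply tyR_okr, RP0).
  pose proof (ok_Int _ O1) as OI.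
  set (GI := cext G1 [] (cst Int)) in *.
  assert (RA0 : tmR G sid G A A (arr X (U k)) (arr X (U k))).
  { apply tmR_id; [exact HG | | exact HA].
    eapply tyR_l, tyR_arr; [exact RX0 | apply tyR_U; [exact k_lt_N | apply wsub_id, HG]]. }
  pose proof (famR_r _ _ _ _ _ _ _ _ _ (famR_generic _ _ _ _ _ _ _ RX0 RA0)) as FA.
  fold G1 in FA.
  pose proof (fam_up _ _ _ _ _ FA OI) as FAI; fold GI in FAI.
  assert (HvI : has_type Sg GI (v 0) (cst Int))
    by (eapply tmR_r, Int_v0, wsub_id, O1).
  set (y := ap (up (v 0)) (v 0) : Tm Sg).
  assert (Hy : has_type Sg GI y (up (up X))).
  { eapply ty_apN; [exact OI | eapply tyR_l, tyR_Int, wsub_id, OI | apply FAI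
      | apply FAI | exact HvI]. }
  set (s2 := scomp wk wk : Su Sg).
  assert (RX : tyR GI s2 G X (up (up X))).
  { eapply tyR_comp; [apply tyR_up; [exact O1 | exact HX] |].
    apply tyR_up; [exact OI |]. eapply tyR_r, tyR_up; [exact O1 | exact HX]. }
  pose proof (tyR_sub _ _ _ _ _ RX) as H2.
  pose proof (tyR_U _ _ _ k k_lt_N H2) as RU.
  pose proof (wsub_lift _ _ _ _ _ RU) as HL2.
  pose proof (tyR_sb _ _ _ _ HL2 HC) as RC.
  pose proof (tyR_Sig _ _ _ _ _ _ _ RU RC) as RS.
  (* [up (up t)] consists of two nested substitutions while [s2] is one composite; this reconciles
     them. *)
  assert (UPUP : forall t T, has_type Sg G T (U N) -> has_type Sg G t T ->
    tmR GI s2 G t (up (up t)) T (up (up T))).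
  { intros t T HT Ht; pose proof (tmR_up _ _ _ _ O1 HT Ht) as R1.
    eapply tmR_comp; [exact R1 |].
    apply tmR_up; [exact OI | apply R1 | apply R1]. }
  set (F2 := up (up F)).
  assert (RF : tmR GI s2 G F F2 (arr X (Sig (U k) C))
    (arr (up (up X)) (Sig (U k) (sb C (lift [] s2))))).
  { pose proof (tyR_arr _ _ _ _ _ _ _ RX RS) as RT.
    eapply tmR_convr; [apply UPUP; [apply RT | exact HF] | exact RT]. }
  pose proof (tmR_r _ _ _ _ _ _ _ RF) as HF2.
  pose proof (tyR_r _ _ _ _ _ RC) as HC2.
  pose proof (tyR_r _ _ _ _ _ RX) as HX2.
  set (Q := ap F2 y).
  assert (HQ : has_type Sg GI Q (Sig (U k) (sb C (lift [] s2)))).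
  { eapply ty_apN; [exact OI | exact HX2 | apply RS | exact HF2 | exact Hy]. }
  assert (HQ1 : has_type Sg GI (pr1 Q) (U k)).
  { eapply ty_pr1; [apply RU | exact HC2 | exact HQ]. }
  pose proof (tyR_id _ _ OI (tyR_r _ _ _ _ _ RU)) as RUI.
  pose proof (wsub_sext _ _ _ _ _ _ RUI HQ1) as HI.
  pose proof (wsub_comp _ _ _ _ _ HL2 HI) as Hsig.
  (* [sig] sends the generic code to [pr1 Q]. It is written as a lift followed by an instantiation
     because the second projection of [Q] receives its type in that form. *)
  set (sig := scomp (lift [] s2) (sext [] sid (pr1 Q))) in *.
  assert (HQ2 : has_type Sg GI (pr2 Q) (sb C sig)).
  { eapply ty_conv; [eapply ty_pr2; [apply RU | exact HC2 | exact HQ] |].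
    eapply teq_sb_comp_U; [apply HI | apply HL2 | exact HC]. }
  assert (Rv : tm_eq Sg GI (sb (v 0) sig) (pr1 Q) (U k)).
  { eapply tmR_eq, tmR_comp; [apply tmR_v0, RU |].
    eapply tmR_v0_sext; [exact RUI | exact HQ1]. }
  destruct (amazing_cov _ _ _ _ O1 HG Hsig HQ2) as [w Hw].
  pose proof (tmR_r _ _ _ _ _ _ _ (tmR_code_fam _ _ _ O1 HG Hsig)) as HLam.
  set (L := lam [] (sb (v 0) sig)) in *.
  pose proof (ty_idI _ O1) as Hid.
  set (idI := lam [] (v 0) : Tm Sg) in *.
  pose proof (wsub_id _ O1) as ID1.
  pose proof (tyR_Int _ _ _ ID1) as RI1.
  assert (RL : tmR G1 sid G1 L L (arr (cst Int) (U k)) (arr (cst Int) (U k))).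
  { apply tmR_id; [exact O1 | | exact HLam].
    eapply tyR_l, tyR_arr; [exact RI1 | apply tyR_U; [exact k_lt_N | exact ID1]]. }
  pose proof (famR_generic_sext _ _ _ _ _ _ _ _ RI1 RL Hid) as FL.
  assert (Hsv : has_type Sg GI (sb (v 0) sig) (U k)).
  { eapply ty_sb_U; [apply Hsig | apply ty_v0_U, HG]. }
  (* At the generic point of I, [L] along the identity and [F_0] along x both reduce to [pr1 Q]. *)
  assert (FE : famE G1 L (up A) idI (v 0)).
  { constructor; [eexists; eapply famR_r, FL | eexists; exact FA |].
    apply teq_le with k; [lia |].
    assert (E1 : tm_eq Sg GI (at_fam (up L) (up idI) (v 0)) (ap (up L) (v 0)) (U k)).
    { pose proof (fam_up _ _ _ _ _ (famR_r _ _ _ _ _ _ _ _ _ FL) OI) as FLI.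
      fold GI in FLI.
      eapply teq_apN; [exact OI | apply FLI | apply RUI | apply teq_refl, FLI | |].
      - eapply ty_apN; [exact OI | eapply tyR_l, tyR_Int, wsub_id, OI | apply FLI
          | apply FLI | exact HvI].
      - apply lam_generic; [exact O1 | apply RI1 | apply FLI | apply ty_v0, OI]. }
    assert (E2 : tm_eq Sg GI (ap (up L) (v 0)) (sb (v 0) sig) (U k)).
    { apply lam_generic; [exact O1 | apply RI1 | apply RUI | exact Hsv]. }
    assert (E3 : tm_eq Sg GI (at_fam (up (up A)) (up (v 0)) (v 0)) (ap (fst_fun F2) y) (U k)).
    { eapply teq_apN; [exact OI | exact HX2 | apply RUI | | exact Hy | apply teq_refl, Hy].
      pose proof (tmR_fst_fun HG HX HC _ _ _ _ _ RX RS RF) as RA2.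
      eapply teq_sym, tmR_fun; [exact RA2 |].
      apply UPUP; [apply RA0 | exact HA]. }
    pose proof (fst_fun_beta OI HX2 HC2 HF2 _ Hy) as E4.
    eapply teq_trans; [exact E1 |]. eapply teq_trans; [exact E2 |].
    eapply teq_trans; [exact Rv |]. apply teq_sym.
    eapply teq_trans; [exact E3 | exact E4]. }
  (* The left-hand type is the codomain of [isCov (cst Int) L] and the substitution instantiates it
     at [idI], so this relation is the conversion needed to type [ap w idI]. *)
  assert (RC1 : tyR G1 (sext [] sid idI) (cext G1 [] (arr (cst Int) (cst Int)))
    (isCovAt (up L) (v 0)) (isCovAt (up A) (v 0))).
  { apply arrR_isCovAt; do 4 eexists; split; [exact FL | exact FE]. }
  exists (lam [] (ap w idI)).
  eapply ty_lam with (i := N); [apply RP0 | apply RC1 |].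
  eapply ty_conv; [| apply RC1].
  eapply ty_app with (i := N); [| apply RC1 | exact Hw | exact Hid].
  eapply tyR_l, tyR_arr; [exact RI1 | exact RI1].
Qed.

End Families.
End Level.
End Calculus.

Theorem mainTheorem14 (S : signature) (G : Ctx S) (i j : nat) (X F : Tm S)
  (HG : ctx_ok S G)
  (HX : has_type S G X (U j))
  (HF : has_type S G F (arr X (Sig (U i) (isAmazinglyCov (v 0))))) :
  exists t : Tm S,
    has_type S G t (isCov X (lam [] (pr1 (ap (up F) (v 0))))).
Proof.
  (* The working level must be strictly above [i], so that [U i] is itself a type of that level, and
     at least [j], so that [X] is one too. *)
  apply (cov_of_amazing_cov (1 + i + j) i ltac:(lia)); [exact HG | | exact HF].
  apply ty_le with j; [lia | exact HX].
Qed.
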